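(* Let $G$ be a discrete group, let $(\tilde A,\tilde\Delta)$ be a multiplier Hopf algebra, and let $\gamma:K(G)\to M(\tilde A)$ be a nondegenerate homomorphism from $K(G)$ into the center of $M(\tilde A)$ satisfying $$\tilde\Delta(\gamma(f))=(\gamma\otimes\gamma)(\Delta_\circ(f))\qquad\text{for all } f\in K(G).$$ Then this comes from a multiplier Hopf $G$-coalgebra: there exist a multiplier Hopf $G$-coalgebra $(A=\{A_p\}_{p\in G},\Delta=\{\Delta_{p,q}\}_{p,q\in G})$ and an algebra isomorphism $\varphi:\tilde A\to A_G=\bigoplus_{p\in G}A_p$ such that $\Delta_G(\varphi(a))=(\varphi\otimes\varphi)(\tilde\Delta(a))$ for all $a\in\tilde A$, and (the extension to multipliers of) $\varphi$ carries $\gamma(f)$ to $\gamma_G(f)$ for all $f\in K(G)$, where $\gamma_G(f)(p)=f(p)1_p$ with $1_p$ the unit of $M(A_p)$.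
   Context: Algebras are associative over $\mathbb{C}$, possibly without unit, with nondegenerate product ($ab=0$ for all $a$ implies $b=0$, and $ab=0$ for all $b$ implies $a=0$). The multiplier algebra $M(A)$ consists of pairs $(L,R)$ of linear maps $A\to A$ with $L(ab)=L(a)b$, $R(ab)=aR(b)$, $R(a)b=aL(b)$; for $x=(L,R)$ write $xa=L(a)$, $ax=R(a)$; $A\otimes B\subseteq M(A)\otimes M(B)\subseteq M(A\otimes B)$. A homomorphism $\varphi:A\to M(B)$ is nondegenerate if $B$ is spanned by the elements $\varphi(a)b$ and also by the elements $b\varphi(a)$; it then extends uniquely to a homomorphism $M(A)\to M(B)$. Such extensions are used tacitly. $I$ is the identity map. Multiplier Hopf $G$-coalgebra: a family $A=\{A_p\}_{p\in G}$ of such algebras with homomorphisms $\Delta_{p,q}:A_{pq}\to M(A_p\otimes A_q)$ such that for all $p,q,r\in G$: (1) $\Delta_{p,q}(a)(1\otimes b)\in A_p\otimes A_q$ for $a\in A_{pq}$, $b\in A_q$, and $(a\otimes 1)\Delta_{p,q}(b)\in A_p\otimes A_q$ for $a\in A_p$, $b\in A_{pq}$; (2) $(a\otimes1\otimes1)(\Delta_{p,q}\otimes I)(\Delta_{pq,r}(b)(1\otimes c))=(I\otimes\Delta_{q,r})((a\otimes1)\Delta_{p,qr}(b))(1\otimes1\otimes c)$ for $a\in A_p$, $b\in A_{pqr}$, $c\in A_r$; (3) the maps $A_{pq}\otimes A_q\to A_p\otimes A_q$, $a\otimes b\mapsto\Delta_{p,q}(a)(1\otimes b)$, and $A_p\otimes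 A_{pq}\to A_p\otimes A_q$, $a\otimes b\mapsto(a\otimes1)\Delta_{p,q}(b)$, are bijective. A multiplier Hopf algebra is the case of the trivial group: a single algebra $A$ with $\Delta:A\to M(A\otimes A)$ satisfying (1)–(3). Elements of $A_G$ are finitely supported functions $a$ on $G$ with $a(p)\in A_p$, multiplied pointwise; $M(A_G\otimes A_G)$ is identified with all functions $x$ on $G\times G$ with $x(p,q)\in M(A_p\otimes A_q)$, and $M(A_G)$ with all functions $x$ on $G$ with $x(p)\in M(A_p)$. The comultiplication on $A_G$ is $\Delta_G(a)(p,q)=\Delta_{p,q}(a(pq))$, which makes $A_G$ a multiplier Hopf algebra. $K(G)$ is the algebra of finitely supported complex functions on $G$ with pointwise product, and $\Delta_\circ(f)(p,q)=f(pq)$ in $M(K(G)\otimes K(G))$, the algebra of all complex functions on $G\times G$. *)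

(* Defs.v *)
From HB Require Import structures.
From mathcomp Require Import all_boot all_order all_algebra.
From mathcomp Require Import boolp classical_sets functions cardinality fsbigop reals.
From mathcomp Require Import finmap complex.

Set Implicit Arguments.
Unset Strict Implicit.
Unset Printing Implicit Defensive.

Import GRing.Theory.
Local Open Scope ring_scope.
Local Open Scope classical_set_scope.
Local Open Scope quotient_scope.
#[local] Obligation Tactic := idtac.

HB.mixin Record isNualg (K : fieldType) A of GRing.Lmodule K A := {
  amul : A -> A -> A;
  amulA : associative amul;
  amulDl : left_distributive amul +%R;
  amulDr : right_distributive amul +%R;
  amulZl : forall (k : K) (a b : A), amul (k *: a) b = k *: amul a b;
  amulZr : forall (k : K) (a b : A), amul a (k *: b) = k *: amul a b
}.

#[short(type="nualgType")]
HB.structure Definition Nualg (K : fieldType) :=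
  {A of isNualg K A & GRing.Lmodule K A}.

Notation "a ** b" := (amul a b) (at level 40, left associativity) : ring_scope.

Notation is_bilinear f := (bilinear_for *:%R *:%R f).

Section NualgTheory.
Context {K : fieldType}.
Implicit Types A B : nualgType K.

Lemma amul0l A (a : A) : 0 ** a = 0.
Proof. by rewrite -[X in X ** a](scale0r (0 : A)) amulZl scale0r. Qed.

Lemma amul0r A (a : A) : a ** 0 = 0.
Proof. by rewrite -[X in a ** X](scale0r (0 : A)) amulZr scale0r. Qed.

Lemma amul_bilinear A : is_bilinear (@amul K A).
Proof.
by split=> u k a b /=; rewrite ?(amulDl, amulZl) // amulDr amulZr.
Qed.

Definition nondegenerate_product A : Prop :=
  (forall b : A, (forall a, a ** b = 0) -> b = 0) /\
  (forall a : A, (forall b, a ** b = 0) -> a = 0).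

Definition alg_hom A B (f : A -> B) : Prop :=
  linear f /\ {morph f : a b / a ** b}.

Definition lspan (V : lmodType K) (S : set V) : set V :=
  [set v | exists (n : nat) (k : 'I_n -> K) (u : 'I_n -> V),
     (forall i, S (u i)) /\ v = \sum_i k i *: u i].

End NualgTheory.

Section Multiplier.
Context {K : fieldType}.

Definition is_mult (A : nualgType K) : {pred (A -> A) * (A -> A)} := fun x =>
  `[< [/\ linear x.1, linear x.2,
          forall a b, x.1 (a ** b) = x.1 a ** b,
          forall a b, x.2 (a ** b) = a ** x.2 b
        & forall a b, x.2 a ** b = a ** x.1 b] >].
Arguments is_mult : clear implicits.

Record mult (A : nualgType K) : Type :=
  Mult { mval : (A -> A) * (A -> A); mvalP : mval \in is_mult A }.

Variable A : nualgType K.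

HB.instance Definition _ := [isSub for @mval A].
HB.instance Definition _ := [Choice of mult A by <:].

Lemma is_mult_submod : submod_closed (is_mult A).
Proof.
split=> [|k x y]; rewrite !unfold_in /=.
  have z a : ((0 : (A -> A) * (A -> A)).1 a = 0) by [].
  have z' a : ((0 : (A -> A) * (A -> A)).2 a = 0) by [].
  apply/asboolP; split=> [l a b|l a b|a b|a b|a b]; rewrite ?(z, z').
  - by rewrite scaler0 addr0.
  - by rewrite scaler0 addr0.
  - by rewrite amul0l.
  - by rewrite amul0r.
  - by rewrite amul0l amul0r.
move=> /asboolP[xL xR x1 x2 x3] /asboolP[yL yR y1 y2 y3].
have e (f g : A -> A) a : (k *: f + g) a = k *: f a + g a by [].
apply/asboolP; split=> [l a b|l a b|a b|a b|a b]; rewrite !e.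
- by rewrite xL yL !scalerDr addrACA !scalerA mulrC.
- by rewrite xR yR !scalerDr addrACA !scalerA mulrC.
- by rewrite x1 y1 amulDl amulZl.
- by rewrite x2 y2 amulDr amulZr.
- by rewrite amulDl amulZl x3 y3 amulDr amulZr.
Qed.

HB.instance Definition _ :=
  GRing.isSubmodClosed.Build _ _ (is_mult A) is_mult_submod.
HB.instance Definition _ := [SubChoice_isSubLmodule of mult A by <:].

(* For x = (L, R): x a = L(a) and a x = R(a), so that products of multipliers
   compose the first components and compose the second ones in reverse. *)
Definition lact (x : mult A) (a : A) : A := (val x).1 a.
Definition ract (a : A) (x : mult A) : A := (val x).2 a.

Lemma multP (x : mult A) : [/\ linear (lact x), linear (ract^~ x),
    forall a b, lact x (a ** b) = lact x a ** b,
    forall a b, ract (a ** b) x = a ** ract b x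
  & forall a b, ract a x ** b = a ** lact x b].
Proof. by have := mvalP x; rewrite unfold_in => /asboolP. Qed.

Lemma lact_linear x : linear (lact x). Proof. by case: (multP x). Qed.
Lemma ract_linear x : linear (ract^~ x). Proof. by case: (multP x). Qed.
Lemma lactM x a b : lact x (a ** b) = lact x a ** b.
Proof. by case: (multP x). Qed.
Lemma ractM x a b : ract (a ** b) x = a ** ract b x.
Proof. by case: (multP x). Qed.
Lemma ract_lact x a b : ract a x ** b = a ** lact x b.
Proof. by case: (multP x). Qed.

Lemma mult_ext (x y : mult A) :
  (forall a, lact x a = lact y a) -> (forall a, ract a x = ract a y) -> x = y.
Proof.
move=> h1 h2; apply: val_inj; rewrite [LHS]surjective_pairing.
by rewrite [RHS]surjective_pairing; congr pair; apply/funext.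
Qed.

Lemma mkmult_subproof (L R : A -> A) : linear L -> linear R ->
  (forall a b, L (a ** b) = L a ** b) -> (forall a b, R (a ** b) = a ** R b) ->
  (forall a b, R a ** b = a ** L b) -> (L, R) \in is_mult A.
Proof. by move=> *; rewrite unfold_in; apply/asboolP; split. Qed.

Definition mkmult L R hL hR h1 h2 h3 : mult A :=
  Mult (@mkmult_subproof L R hL hR h1 h2 h3).

Definition mone : mult A :=
  @mkmult idfun idfun (fun _ _ _ => erefl) (fun _ _ _ => erefl)
    (fun _ _ => erefl) (fun _ _ => erefl) (fun _ _ => erefl).

Program Definition mmul (x y : mult A) : mult A :=
  @mkmult (lact x \o lact y) (fun a => ract (ract a x) y) _ _ _ _ _.
Next Obligation. by move=> x y k a b /=; rewrite !lact_linear. Qed.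
Next Obligation. by move=> x y k a b /=; rewrite !ract_linear. Qed.
Next Obligation. by move=> x y a b /=; rewrite !lactM. Qed.
Next Obligation. by move=> x y a b /=; rewrite !ractM. Qed.
Next Obligation. by move=> x y a b /=; rewrite !ract_lact. Qed.

Lemma lactD x y a : lact (x + y) a = lact x a + lact y a.
Proof. by []. Qed.
Lemma ractD x y a : ract a (x + y) = ract a x + ract a y.
Proof. by []. Qed.
Lemma lactZ k x a : lact (k *: x) a = k *: lact x a.
Proof. by []. Qed.
Lemma ractZ k x a : ract a (k *: x) = k *: ract a x.
Proof. by []. Qed.

Lemma mmulA : associative mmul.
Proof. by move=> x y z; apply: mult_ext. Qed.

Lemma mmulDl : left_distributive mmul +%R.
Proof.
move=> x y z; apply: mult_ext => a //.
by have := ract_linear z 1 (ract a x) (ract a y); rewrite !scale1r.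
Qed.

Lemma mmulDr : right_distributive mmul +%R.
Proof.
move=> x y z; apply: mult_ext => a //.
by have := lact_linear x 1 (lact y a) (lact z a); rewrite !scale1r.
Qed.

Lemma linear0' (U V : lmodType K) (f : U -> V) : linear f -> f 0 = 0.
Proof.
by move=> lf; have := lf (-1) 0 0; rewrite scaleN1r oppr0 addr0 scaleN1r addNr.
Qed.

Lemma linearZ' (U V : lmodType K) (f : U -> V) k u :
  linear f -> f (k *: u) = k *: f u.
Proof. by move=> lf; have := lf k u 0; rewrite (linear0' lf) !addr0. Qed.

Lemma linearD' (U V : lmodType K) (f : U -> V) u v :
  linear f -> f (u + v) = f u + f v.
Proof. by move=> lf; have := lf 1 u v; rewrite !scale1r. Qed.

Lemma linear_sum' (U V : lmodType K) (f : U -> V) I (r : seq I) (F : I -> U) :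
  linear f -> f (\sum_(i <- r) F i) = \sum_(i <- r) f (F i).
Proof.
by move=> lf; apply: (big_morph f) => [u v|]; [exact: linearD'|exact: linear0'].
Qed.

Lemma mmulZl k x y : mmul (k *: x) y = k *: mmul x y.
Proof.
apply: mult_ext => a //.
exact: (linearZ' _ _ (ract_linear y)).
Qed.

Lemma mmulZr k x y : mmul x (k *: y) = k *: mmul x y.
Proof.
apply: mult_ext => a //.
exact: (linearZ' _ _ (lact_linear x)).
Qed.

HB.instance Definition _ :=
  isNualg.Build K (mult A) mmulA mmulDl mmulDr mmulZl mmulZr.

Program Definition memb (c : A) : mult A :=
  @mkmult (amul c) (amul^~ c) _ _ _ _ _.
Next Obligation. by move=> c k a b; rewrite amulDr amulZr. Qed.
Next Obligation. by move=> c k a b; rewrite amulDl amulZl. Qed.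
Next Obligation. by move=> c a b; rewrite amulA. Qed.
Next Obligation. by move=> c a b /=; rewrite -amulA. Qed.
Next Obligation. by move=> c a b /=; rewrite -amulA. Qed.

Lemma memb_hom : alg_hom memb.
Proof.
split=> [k a b|a b]; apply: mult_ext => c; rewrite /memb /lact /ract /=.
- by rewrite amulDl amulZl.
- by rewrite amulDr amulZr.
- exact: esym (amulA _ _ _).
- exact: amulA.
Qed.

End Multiplier.
Arguments mone {K A}.

Section Tensor.
Context {K : fieldType}.
Variables U V : lmodType K.

Definition formal_eval (W : lmodType K) (f : U -> V -> W) (s : seq (U * V)) : W :=
  \sum_(z <- s) f z.1 z.2.

(* A sequence of pairs (u, v) stands for the formal sum of the u (x) v; two
   formal sums are identified when no bilinear map tells them apart. *)
Definition tens_eq : rel (seq (U * V)) := fun s t =>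
  `[< forall (W : lmodType K) (f : U -> V -> W), is_bilinear f ->
        formal_eval f s = formal_eval f t >].

Lemma tens_eq_equiv : equiv_class_of tens_eq.
Proof.
split=> [s|s t|t s r].
- exact/asboolP.
- by apply/asboolP/asboolP => h W f bf; rewrite h.
- move=> /asboolP h1 /asboolP h2; apply/asboolP => W f bf.
  by rewrite h1 // h2.
Qed.

Canonical tens_equiv := EquivRelPack tens_eq_equiv.

Definition tens : Type := {eq_quot tens_equiv}.
HB.instance Definition _ := Choice.on tens.

(* the linear map on the tensor product induced by f, when f is bilinear *)
Definition tlift (W : lmodType K) (f : U -> V -> W) (x : tens) : W :=
  formal_eval f (repr (x : {eq_quot tens_equiv})).

Definition tclass (s : seq (U * V)) : tens := \pi_{eq_quot tens_equiv} s.

Lemma tlift_class (W : lmodType K) (f : U -> V -> W) s :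
  is_bilinear f -> tlift f (tclass s) = formal_eval f s.
Proof.
move=> bf; have : tens_eq (repr (\pi_{eq_quot tens_equiv} s)) s.
  by apply/eqmodP; rewrite reprK.
by move=> /asboolP; apply.
Qed.

Lemma tlift_ext (x y : tens) :
  (forall (W : lmodType K) (f : U -> V -> W), is_bilinear f ->
     tlift f x = tlift f y) -> x = y.
Proof.
move=> h; rewrite -[x](@reprK _ {eq_quot tens_equiv}).
by rewrite -[y](@reprK _ {eq_quot tens_equiv}); apply/eqmodP/asboolP.
Qed.

Let tzero := tclass [::].
Let tadd (x y : tens) : tens :=
  tclass (repr (x : {eq_quot tens_equiv}) ++ repr (y : {eq_quot tens_equiv})).
Let tscale (k : K) (x : tens) : tens :=
  tclass [seq (k *: z.1, z.2) | z <- repr (x : {eq_quot tens_equiv})].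
Let topp := tscale (-1).

Section Bil.
Variables (W : lmodType K) (f : U -> V -> W).
Hypothesis bf : is_bilinear f.

Lemma bilinDl u u' v : f (u + u') v = f u v + f u' v.
Proof. exact: (linearD' u u' (bf.1 v)). Qed.
Lemma bilinDr u v v' : f u (v + v') = f u v + f u v'.
Proof. exact: (linearD' v v' (bf.2 u)). Qed.
Lemma bilinZl k u v : f (k *: u) v = k *: f u v.
Proof. exact: (linearZ' k u (bf.1 v)). Qed.
Lemma bilinZr k u v : f u (k *: v) = k *: f u v.
Proof. exact: (linearZ' k v (bf.2 u)). Qed.

Let tlift0 : tlift f tzero = 0.
Proof. by rewrite tlift_class // /formal_eval big_nil. Qed.
Let tliftD x y : tlift f (tadd x y) = tlift f x + tlift f y.
Proof. by rewrite tlift_class // /formal_eval big_cat. Qed.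
Let tliftZ k x : tlift f (tscale k x) = k *: tlift f x.
Proof.
rewrite tlift_class // /formal_eval big_map /tlift /formal_eval scaler_sumr.
by apply: eq_bigr => z _; rewrite bilinZl.
Qed.

Definition tliftE := (tlift0, tliftD, tliftZ).
End Bil.

Let taddA : associative tadd.
Proof.
by move=> x y z; apply: tlift_ext => W f bf; rewrite !(tliftE bf) addrA.
Qed.
Let taddC : commutative tadd.
Proof.
by move=> x y; apply: tlift_ext => W f bf; rewrite !(tliftE bf) addrC.
Qed.
Let tadd0 : left_id tzero tadd.
Proof.
by move=> x; apply: tlift_ext => W f bf; rewrite !(tliftE bf) add0r.
Qed.
Let taddN : left_inverse tzero topp tadd.
Proof.
move=> x; apply: tlift_ext => W f bf.
by rewrite !(tliftE bf) scaleN1r addNr.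
Qed.

HB.instance Definition _ := GRing.isZmodule.Build tens taddA taddC tadd0 taddN.

Let tscaleA k l x : tscale k (tscale l x) = tscale (k * l) x.
Proof. by apply: tlift_ext => W f bf; rewrite !(tliftE bf) scalerA. Qed.
Let tscale1 : left_id 1 tscale.
Proof.
by move=> x; apply: tlift_ext => W f bf; rewrite !(tliftE bf) scale1r.
Qed.
Let tscaleDr : right_distributive tscale +%R.
Proof.
move=> k x y; apply: tlift_ext => W f bf.
by rewrite !(tliftE bf) scalerDr.
Qed.
Let tscaleDl x : {morph tscale^~ x : k l / k + l}.
Proof.
move=> k l; apply: tlift_ext => W f bf.
by rewrite !(tliftE bf) scalerDl.
Qed.

HB.instance Definition _ :=
  GRing.Zmodule_isLmodule.Build K tens tscaleA tscale1 tscaleDr tscaleDl.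

Definition tpure (u : U) (v : V) : tens := tclass [:: (u, v)].

Lemma tlift_linear (W : lmodType K) (f : U -> V -> W) :
  is_bilinear f -> linear (tlift f).
Proof. by move=> bf k x y; rewrite !(tliftE bf). Qed.

Lemma tlift_pure (W : lmodType K) (f : U -> V -> W) u v :
  is_bilinear f -> tlift f (tpure u v) = f u v.
Proof. by move=> bf; rewrite tlift_class // /formal_eval big_seq1. Qed.

Lemma tpure_bilinear : is_bilinear tpure.
Proof.
split=> [v k u u'|u k v v']; apply: tlift_ext => W f bf;
  rewrite !(tliftE bf) !tlift_pure //.
- by rewrite bilinDl // bilinZl.
- by rewrite bilinDr // bilinZr.
Qed.

Lemma tens_sum (x : tens) :
  exists s : seq (U * V), x = \sum_(z <- s) tpure z.1 z.2.
Proof.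
exists (repr (x : {eq_quot tens_equiv})); apply: tlift_ext => W f bf.
rewrite (linear_sum' _ _ (tlift_linear bf)).
by apply: eq_bigr => z _; rewrite tlift_pure.
Qed.

Lemma tens_ind (P : tens -> Prop) : P 0 -> (forall u v, P (tpure u v)) ->
  (forall x y, P x -> P y -> P (x + y)) -> forall x, P x.
Proof.
move=> P0 P1 PD x; have [s ->] := tens_sum x.
by elim/big_rec: _ => // z y _; apply: PD.
Qed.

Lemma tens_eq_linear (W : lmodType K) (f g : tens -> W) :
  linear f -> linear g -> (forall u v, f (tpure u v) = g (tpure u v)) ->
  forall x, f x = g x.
Proof.
move=> lf lg h; elim/tens_ind=> [|u v|x y hx hy]; first by rewrite !linear0'.
  exact: h.
by rewrite !linearD' // hx hy.
Qed.

End Tensor.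

Notation "u ⊗ v" := (tpure u v) (at level 40, left associativity) : ring_scope.

Section TensorMaps.
Context {K : fieldType}.

Lemma tlift_comb (U V W : lmodType K) (f g h : U -> V -> W) k x :
  (forall u v, f u v = k *: g u v + h u v) ->
  tlift f x = k *: tlift g x + tlift h x.
Proof.
move=> e; rewrite /tlift /formal_eval scaler_sumr -big_split /=.
by apply: eq_bigr => z _; rewrite e.
Qed.

Definition tmap (U V U' V' : lmodType K) (f : U -> U') (g : V -> V') :
  tens U V -> tens U' V' := tlift (fun u v => f u ⊗ g v).

Section Tmap.
Variables (U V U' V' : lmodType K) (f : U -> U') (g : V -> V').
Hypotheses (lf : linear f) (lg : linear g).

Lemma tmap_bilinear : is_bilinear (fun u v => f u ⊗ g v).
Proof.
have bt := tpure_bilinear U' V'.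
split=> [v k u u'|u k v v'] /=.
- by rewrite lf (bilinDl bt) (bilinZl bt).
- by rewrite lg (bilinDr bt) (bilinZr bt).
Qed.

Lemma tmap_linear : linear (tmap f g).
Proof. exact: tlift_linear tmap_bilinear. Qed.

Lemma tmap_pure u v : tmap f g (u ⊗ v) = f u ⊗ g v.
Proof. by rewrite [LHS]tlift_pure //; exact: tmap_bilinear. Qed.
End Tmap.

Section TensorAlgebra.
Variables A B : nualgType K.

Let bt := tpure_bilinear A B.

Definition tmul (x y : tens A B) : tens A B :=
  tlift (fun a b => tlift (fun a' b' => (a ** a') ⊗ (b ** b')) y) x.

Let bin a b : is_bilinear (fun a' b' => (a ** a') ⊗ (b ** b') : tens A B).
Proof.
split=> [v k u u'|u k v v'] /=.
- by rewrite amulDr amulZr (bilinDl bt) (bilinZl bt).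
- by rewrite amulDr amulZr (bilinDr bt) (bilinZr bt).
Qed.

Let bout (y : tens A B) : is_bilinear
  (fun a b => tlift (fun a' b' => (a ** a') ⊗ (b ** b')) y : tens A B).
Proof.
split=> [v k u u'|u k v v'] /=; apply: tlift_comb => a b.
- by rewrite amulDl amulZl (bilinDl bt) (bilinZl bt).
- by rewrite amulDl amulZl (bilinDr bt) (bilinZr bt).
Qed.

Lemma tmul_bilinear : is_bilinear tmul.
Proof.
split=> [y k x x'|x k y y'].
  exact: (tlift_linear (bout y)).
by apply: tlift_comb => a b; exact: (tlift_linear (bin a b)).
Qed.

Lemma tmul_pure a b a' b' : tmul (a ⊗ b) (a' ⊗ b') = (a ** a') ⊗ (b ** b').
Proof. by rewrite /tmul tlift_pure ?tlift_pure. Qed.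

Let bm := tmul_bilinear.

Let tmulA : associative tmul.
Proof.
move=> x y z; move: x; apply: tens_ind => [|a b|x x' hx hx'].
- by rewrite !(linear0' (bm.1 _)).
- move: y; apply: tens_ind => [|a' b'|y y' hy hy'].
  + by rewrite !(linear0' (bm.1 _), linear0' (bm.2 _)).
  + move: z; apply: tens_ind => [|a'' b''|z z' hz hz'].
    * by rewrite !(linear0' (bm.2 _)).
    * by rewrite !tmul_pure !amulA.
    * by rewrite !(bilinDr bm) hz hz'.
  + by rewrite (bilinDl bm) !(bilinDr bm) (bilinDl bm) hy hy'.
- by rewrite !(bilinDl bm) hx hx'.
Qed.
Let tmulDl : left_distributive tmul +%R.
Proof. by move=> x y z; exact: (bilinDl bm). Qed.
Let tmulDr : right_distributive tmul +%R.
Proof. by move=> x y z; exact: (bilinDr bm). Qed.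
Let tmulZl k x y : tmul (k *: x) y = k *: tmul x y.
Proof. exact: (bilinZl bm). Qed.
Let tmulZr k x y : tmul x (k *: y) = k *: tmul x y.
Proof. exact: (bilinZr bm). Qed.

HB.instance Definition _ :=
  isNualg.Build K (tens A B) tmulA tmulDl tmulDr tmulZl tmulZr.

Lemma amul_pure (a a' : A) (b b' : B) :
  (a ⊗ b : tens A B) ** (a' ⊗ b') = (a ** a') ⊗ (b ** b').
Proof. exact: tmul_pure. Qed.

End TensorAlgebra.

Lemma tens_eq_bilinear (U V U' V' W : lmodType K)
    (f g : tens U V -> tens U' V' -> W) :
  is_bilinear f -> is_bilinear g ->
  (forall u v u' v', f (u ⊗ v) (u' ⊗ v') = g (u ⊗ v) (u' ⊗ v')) ->
  forall x y, f x y = g x y.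
Proof.
move=> bf bg h x y; apply: (tens_eq_linear (bf.1 y) (bg.1 y)) => u v.
exact: (tens_eq_linear (bf.2 _) (bg.2 _)).
Qed.

Lemma bilin_comp (U V W U' V' W' : lmodType K) (f : U -> V -> W)
  (g : U' -> U) (h : V' -> V) (k : W -> W') : is_bilinear f ->
  linear g -> linear h -> linear k -> is_bilinear (fun x y => k (f (g x) (h y))).
Proof.
move=> bf lg lh lk; split=> [v c u u'|u c v v'] /=.
- by rewrite lg (bilinDl bf) (bilinZl bf) lk.
- by rewrite lh (bilinDr bf) (bilinZr bf) lk.
Qed.

Lemma linear_id (U : lmodType K) : linear (@id U).
Proof. by []. Qed.

Lemma tmap_hom (A B A' B' : nualgType K) (f : A -> A') (g : B -> B') :
  alg_hom f -> alg_hom g -> alg_hom (tmap f g).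
Proof.
move=> [lf mf] [lg mg]; have lt := tmap_linear lf lg; split=> //.
apply: (tens_eq_bilinear
  (f := fun x y => tmap f g (x ** y)) (g := fun x y => tmap f g x ** tmap f g y)).
- exact: (bilin_comp (amul_bilinear _) (@linear_id _) (@linear_id _) lt).
- exact: (bilin_comp (amul_bilinear _) lt lt (@linear_id _)).
- by move=> u v u' v'; rewrite !(amul_pure, tmap_pure) // mf mg.
Qed.

Section MultTensor.
Variables A B : nualgType K.

Program Definition mtens (x : mult A) (y : mult B) : mult (tens A B) :=
  @mkmult K (tens A B) (tmap (lact x) (lact y))
    (tmap (fun a : A => ract a x) (fun b : B => ract b y)) _ _ _ _ _.
Next Obligation. by move=> x y; apply: tmap_linear; apply: lact_linear. Qed.
Next Obligation. by move=> x y; apply: tmap_linear; apply: ract_linear. Qed.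
Next Obligation.
move=> x y; have l := tmap_linear (lact_linear x) (lact_linear y).
have [lx ly] := (lact_linear x, lact_linear y).
apply: (tens_eq_bilinear
  (f := fun s t : tens A B => tmap _ _ (s ** t)) (g := fun s t : tens A B => tmap _ _ s ** t)).
- exact: (bilin_comp (amul_bilinear _) (@linear_id _) (@linear_id _) l).
- exact: (bilin_comp (amul_bilinear _) l (@linear_id _) (@linear_id _)).
- by move=> u v u' v'; rewrite !(amul_pure, tmap_pure) // !lactM.
Qed.
Next Obligation.
move=> x y; have l := tmap_linear (ract_linear x) (ract_linear y).
have [lx ly] := (ract_linear x, ract_linear y).
apply: (tens_eq_bilinear
  (f := fun s t : tens A B => tmap _ _ (s ** t)) (g := fun s t : tens A B => s ** tmap _ _ t)).
- exact: (bilin_comp (amul_bilinear _) (@linear_id _) (@linear_id _) l).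
- exact: (bilin_comp (amul_bilinear _) (@linear_id _) l (@linear_id _)).
- by move=> u v u' v'; rewrite !(amul_pure, tmap_pure) // !ractM.
Qed.
Next Obligation.
move=> x y; have l := tmap_linear (ract_linear x) (ract_linear y).
have l' := tmap_linear (lact_linear x) (lact_linear y).
have [lx ly] := (ract_linear x, ract_linear y).
have [lx' ly'] := (lact_linear x, lact_linear y).
apply: (tens_eq_bilinear
  (f := fun s t : tens A B => tmap _ _ s ** t) (g := fun s t : tens A B => s ** tmap _ _ t)).
- exact: (bilin_comp (amul_bilinear _) l (@linear_id _) (@linear_id _)).
- exact: (bilin_comp (amul_bilinear _) (@linear_id _) l' (@linear_id _)).
- by move=> u v u' v'; rewrite !(amul_pure, tmap_pure) // !ract_lact.
Qed.

Lemma lact_mtens x y a b : lact (mtens x y) (a ⊗ b) = lact x a ⊗ lact y b.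
Proof. by rewrite [LHS]tmap_pure //; apply: lact_linear. Qed.

Lemma ract_mtens x y a b : ract (a ⊗ b) (mtens x y) = ract a x ⊗ ract b y.
Proof. by rewrite [LHS]tmap_pure //; apply: ract_linear. Qed.

End MultTensor.

Section Associator.

Section Space.
Variables U V W : lmodType K.

Definition tassoc : tens (tens U V) W -> tens U (tens V W) :=
  tlift (fun x w => tlift (fun u v => u ⊗ (v ⊗ w)) x).
Definition tassocV : tens U (tens V W) -> tens (tens U V) W :=
  tlift (fun u x => tlift (fun v w => (u ⊗ v) ⊗ w) x).

Let bt (U V : lmodType K) := tpure_bilinear U V.

Let bi w : is_bilinear (fun (u : U) (v : V) => u ⊗ (v ⊗ w) : tens U (tens V W)).
Proof.
split=> [v k u u'|u k v v'] /=.
- by rewrite (bilinDl (bt _ _)) (bilinZl (bt _ _)).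
- by rewrite (bilinDl (bt _ _)) (bilinZl (bt _ _)) (bilinDr (bt _ _)) (bilinZr (bt _ _)).
Qed.
Let bo : is_bilinear
  (fun x (w : W) => tlift (fun (u : U) (v : V) => u ⊗ (v ⊗ w)) x : tens U (tens V W)).
Proof.
split=> [w|x k w w']; first exact: (tlift_linear (bi w)).
by apply: tlift_comb => u v; rewrite !(bilinDr (bt _ _), bilinZr (bt _ _)).
Qed.
Let bi' u : is_bilinear (fun (v : V) (w : W) => (u ⊗ v) ⊗ w : tens (tens U V) W).
Proof.
split=> [w k v v'|v k w w'] /=.
- by rewrite (bilinDr (bt _ _)) (bilinZr (bt _ _)) (bilinDl (bt _ _)) (bilinZl (bt _ _)).
- by rewrite (bilinDr (bt _ _)) (bilinZr (bt _ _)).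
Qed.
Let bo' : is_bilinear
  (fun (u : U) x => tlift (fun (v : V) (w : W) => (u ⊗ v) ⊗ w) x : tens (tens U V) W).
Proof.
split=> [x k u u'|u]; last exact: (tlift_linear (bi' u)).
by apply: tlift_comb => v w; rewrite !(bilinDl (bt _ _), bilinZl (bt _ _)).
Qed.

Lemma tassoc_linear : linear tassoc. Proof. exact: tlift_linear bo. Qed.
Lemma tassocV_linear : linear tassocV. Proof. exact: tlift_linear bo'. Qed.

Lemma tassoc_pure u v w : tassoc (u ⊗ v ⊗ w) = u ⊗ (v ⊗ w).
Proof. by rewrite /tassoc !tlift_pure. Qed.
Lemma tassocV_pure u v w : tassocV (u ⊗ (v ⊗ w)) = u ⊗ v ⊗ w.
Proof. by rewrite /tassocV !tlift_pure. Qed.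

Lemma tens3_eq_linear (Z : lmodType K) (f g : tens (tens U V) W -> Z) :
  linear f -> linear g -> (forall u v w, f (u ⊗ v ⊗ w) = g (u ⊗ v ⊗ w)) ->
  forall x, f x = g x.
Proof.
move=> lf lg h; apply: tens_eq_linear => // x w.
have l (f' : tens (tens U V) W -> Z) : linear f' -> linear (fun x => f' (x ⊗ w)).
  by move=> lf' k y z; rewrite (bilinDl (bt _ _)) (bilinZl (bt _ _)) lf'.
exact: (tens_eq_linear (l _ lf) (l _ lg)).
Qed.

Lemma tens3_eq_linear' (Z : lmodType K) (f g : tens U (tens V W) -> Z) :
  linear f -> linear g -> (forall u v w, f (u ⊗ (v ⊗ w)) = g (u ⊗ (v ⊗ w))) ->
  forall x, f x = g x.
Proof.
move=> lf lg h; apply: tens_eq_linear => // u x.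
have l (f' : tens U (tens V W) -> Z) : linear f' -> linear (fun x => f' (u ⊗ x)).
  by move=> lf' k y z; rewrite (bilinDr (bt _ _)) (bilinZr (bt _ _)) lf'.
exact: (tens_eq_linear (l _ lf) (l _ lg)).
Qed.

Lemma tassocK : cancel tassoc tassocV.
Proof.
apply: (tens3_eq_linear (f := fun x => tassocV (tassoc x)) (g := id)) => //.
- by move=> k x y; rewrite tassoc_linear tassocV_linear.
- by move=> u v w; rewrite tassoc_pure tassocV_pure.
Qed.

Lemma tassocVK : cancel tassocV tassoc.
Proof.
apply: (tens3_eq_linear' (f := fun x => tassoc (tassocV x)) (g := id)) => //.
- by move=> k x y; rewrite tassocV_linear tassoc_linear.
- by move=> u v w; rewrite tassocV_pure tassoc_pure.
Qed.

End Space.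

Variables A B C : nualgType K.

Lemma tassoc_hom : alg_hom (@tassoc A B C).
Proof.
have l := @tassoc_linear A B C; split=> //.
move=> x y; move: x.
have lm z : linear (fun x : tens (tens A B) C => tassoc (x ** z)).
  by move=> k u v; rewrite (amul_bilinear _).1 l.
have lm' z : linear (fun x : tens (tens A B) C => tassoc x ** tassoc z).
  by move=> k u v; rewrite l (amul_bilinear _).1.
apply: (tens3_eq_linear (lm y) (lm' y)) => a b c; move: y.
have ln z : linear (fun y : tens (tens A B) C => tassoc (z ** y)).
  by move=> k u v; rewrite (amul_bilinear _).2 l.
have ln' z : linear (fun y : tens (tens A B) C => tassoc z ** tassoc y).
  by move=> k u v; rewrite l (amul_bilinear _).2.
apply: (tens3_eq_linear (ln _) (ln' _)) => a' b' c'.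
by rewrite !(tassoc_pure, amul_pure).
Qed.

Lemma tassocV_hom : alg_hom (@tassocV A B C).
Proof.
split=> [|x y]; first exact: tassocV_linear.
by rewrite -[x in LHS]tassocVK -[y in LHS]tassocVK -tassoc_hom.2 tassocK.
Qed.

(* identifies M((A (x) B) (x) C) with M(A (x) (B (x) C)) *)
Program Definition massoc (x : mult (tens (tens A B) C)) :
    mult (tens A (tens B C)) :=
  @mkmult _ _ (fun t => tassoc (lact x (tassocV t)))
              (fun t => tassoc (ract (tassocV t) x)) _ _ _ _ _.
Next Obligation.
by move=> x k s t /=; rewrite tassocV_linear lact_linear tassoc_linear.
Qed.
Next Obligation.
by move=> x k s t /=; rewrite tassocV_linear ract_linear tassoc_linear.
Qed.
Next Obligation.
by move=> x s t /=; rewrite tassocV_hom.2 lactM tassoc_hom.2 tassocVK.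
Qed.
Next Obligation.
by move=> x s t /=; rewrite tassocV_hom.2 ractM tassoc_hom.2 tassocVK.
Qed.
Next Obligation.
move=> x s t /=; rewrite -[t in LHS]tassocVK -[s in RHS]tassocVK.
by rewrite -!tassoc_hom.2 ract_lact.
Qed.

End Associator.

End TensorMaps.

Section Extension.
Context {K : fieldType}.
Variables A B : nualgType K.

Definition nondegenerate_hom (phi : A -> mult B) : Prop :=
  lspan [set lact (phi a) b | a in setT & b in setT] = setT /\
  lspan [set ract b (phi a) | a in setT & b in setT] = setT.

(* The homomorphism M(A) -> M(B) extending phi. It is meaningful for phi
   nondegenerate, where it exists (mextP) and is unique (mext_uniq). *)
Definition mext (phi : A -> mult B) : mult A -> mult B :=
  xget (fun=> 0)
    [set psi | alg_hom psi /\ forall a, psi (memb a) = phi a].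

Lemma memb_lact (x : mult A) a : x ** memb a = memb (lact x a).
Proof.
apply: mult_ext => c; first exact: lactM.
exact: ract_lact.
Qed.

Lemma memb_ract (x : mult A) a : memb a ** x = memb (ract a x).
Proof.
apply: mult_ext => c; first exact: esym (ract_lact _ _ _).
exact: ractM.
Qed.

Variable phi : A -> mult B.
Hypotheses (ndB : nondegenerate_product B) (hphi : alg_hom phi).
Hypothesis ndphi : nondegenerate_hom phi.

Let span_l (P : B -> Prop) : P 0 -> (forall u v, P u -> P v -> P (u + v)) ->
  (forall a b, P (lact (phi a) b)) -> forall b, P b.
Proof.
move=> P0 PD P1 b.
have : lspan [set lact (phi a) b | a in setT & b in setT] b by rewrite ndphi.1.
move=> [n [k [u [hu ->]]]]; elim/big_rec: _ => // i v _ Pv; apply: PD => //.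
have [a _ [c _ <-]] := hu i.
by rewrite -(linearZ' _ _ (lact_linear _)).
Qed.

Let span_r (P : B -> Prop) : P 0 -> (forall u v, P u -> P v -> P (u + v)) ->
  (forall a b, P (ract b (phi a))) -> forall b, P b.
Proof.
move=> P0 PD P1 b.
have : lspan [set ract b (phi a) | a in setT & b in setT] b by rewrite ndphi.2.
move=> [n [k [u [hu ->]]]]; elim/big_rec: _ => // i v _ Pv; apply: PD => //.
have [a _ [c _ <-]] := hu i.
by rewrite -(linearZ' _ _ (ract_linear _)).
Qed.

Let lD (x : mult B) u v : lact x (u + v) = lact x u + lact x v.
Proof. exact: linearD' (lact_linear x). Qed.
Let rD (x : mult B) u v : ract (u + v) x = ract u x + ract v x.
Proof. exact: linearD' (ract_linear x). Qed.
Let l0 (x : mult B) : lact x 0 = 0.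
Proof. exact: linear0' (lact_linear x). Qed.
Let r0 (x : mult B) : ract 0 x = 0.
Proof. exact: linear0' (ract_linear x). Qed.

Let phi_lactM a a' b : lact (phi (a ** a')) b = lact (phi a) (lact (phi a') b).
Proof. by rewrite hphi.2. Qed.
Let phi_ractM a a' b : ract b (phi (a ** a')) = ract (ract b (phi a)) (phi a').
Proof. by rewrite hphi.2. Qed.

Let inj_l c c' : (forall a, lact (phi a) c = lact (phi a) c') -> c = c'.
Proof.
move=> h; apply/eqP; rewrite -subr_eq0; apply/eqP; apply: ndB.1.
apply: span_r => [|u v hu hv|a b]; first exact: amul0l.
  by rewrite amulDl hu hv addr0.
rewrite ract_lact -scaleN1r addrC (lact_linear _ (-1) c' c) h.
by rewrite scaleN1r addNr amul0r.
Qed.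

Let inj_r c c' : (forall a, ract c (phi a) = ract c' (phi a)) -> c = c'.
Proof.
move=> h; apply/eqP; rewrite -subr_eq0; apply/eqP; apply: ndB.2.
apply: span_l => [|u v hu hv|a b]; first exact: amul0r.
  by rewrite amulDr hu hv addr0.
rewrite -ract_lact -scaleN1r addrC (ract_linear _ (-1) c' c) h.
by rewrite scaleN1r addNr amul0l.
Qed.

Let extL m b := xget 0 [set c | forall a, lact (phi a) c = lact (phi (ract a m)) b].
Let extR m b := xget 0 [set c | forall a, ract c (phi a) = ract b (phi (lact m a))].

Let extLE m b a : lact (phi a) (extL m b) = lact (phi (ract a m)) b.
Proof.
suff [c hc] : exists c, forall a, lact (phi a) c = lact (phi (ract a m)) b.
  by have := xgetI 0 (hc : [set c | _] c); apply.
move: b; apply: span_l => [|u v [c hc] [d hd]|a' b].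
- by exists 0 => a'; rewrite !l0.
- by exists (c + d) => a'; rewrite !lD hc hd.
- exists (lact (phi (lact m a')) b) => a''.
  by rewrite -!phi_lactM ract_lact.
Qed.

Let extRE m b a : ract (extR m b) (phi a) = ract b (phi (lact m a)).
Proof.
suff [c hc] : exists c, forall a, ract c (phi a) = ract b (phi (lact m a)).
  by have := xgetI 0 (hc : [set c | _] c); apply.
move: b; apply: span_r => [|u v [c hc] [d hd]|a' b].
- by exists 0 => a'; rewrite !r0.
- by exists (c + d) => a'; rewrite !rD hc hd.
- exists (ract b (phi (ract a' m))) => a''.
  by rewrite -!phi_ractM ract_lact.
Qed.

Program Let extm (m : mult A) : mult B := @mkmult K B (extL m) (extR m) _ _ _ _ _.
Next Obligation.
move=> m k u v; apply: inj_l => a.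
by rewrite lact_linear !extLE lact_linear.
Qed.
Next Obligation.
move=> m k u v; apply: inj_r => a.
by rewrite (ract_linear (phi a)) !extRE ract_linear.
Qed.
Next Obligation. by move=> m u v; apply: inj_l => a; rewrite lactM !extLE lactM. Qed.
Next Obligation. by move=> m u v; apply: inj_r => a; rewrite ractM !extRE ractM. Qed.
Next Obligation.
move=> m u v; move: u; apply: span_r => [|u u' hu hu'|a b].
- have -> : extR m 0 = 0 by apply: inj_r => a; rewrite extRE !r0.
  by rewrite !amul0l.
- have -> : extR m (u + u') = extR m u + extR m u'.
    by apply: inj_r => a; rewrite extRE !rD !extRE.
  by rewrite !amulDl hu hu'.
- have -> : extR m (ract b (phi a)) = ract b (phi (ract a m)).
    by apply: inj_r => a'; rewrite extRE -!phi_ractM ract_lact.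
  by rewrite !ract_lact extLE.
Qed.

Lemma mext_uniq (psi psi' : mult A -> mult B) :
  alg_hom psi -> (forall a, psi (memb a) = phi a) ->
  alg_hom psi' -> (forall a, psi' (memb a) = phi a) -> psi = psi'.
Proof.
move=> [_ h1] e1 [_ h2] e2; apply/funext => m; apply: mult_ext => b.
  apply: inj_l => a; rewrite -[in LHS]e1 -[in RHS]e2.
  rewrite -[LHS]/(lact (psi (memb a) ** psi m) b) -h1 memb_ract e1.
  by rewrite -[RHS]/(lact (psi' (memb a) ** psi' m) b) -h2 memb_ract e2.
apply: inj_r => a; rewrite -[in LHS]e1 -[in RHS]e2.
rewrite -[LHS]/(ract b (psi m ** psi (memb a))) -h1 memb_lact e1.
by rewrite -[RHS]/(ract b (psi' m ** psi' (memb a))) -h2 memb_lact e2.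
Qed.

Lemma mextP : alg_hom (mext phi) /\ forall a, mext phi (memb a) = phi a.
Proof.
have lphi := hphi.1.
suff h : [set psi | alg_hom psi /\ forall a, psi (memb a) = phi a] extm.
  exact: (xgetI (fun=> 0) h).
have eL m b : lact (extm m) b = extL m b by [].
have eR m b : ract b (extm m) = extR m b by [].
split; first split.
- move=> k m m'; apply: mult_ext => b.
    apply: inj_l => a; rewrite lactD lactZ !eL (lact_linear _ k) !extLE.
    by rewrite ractD ractZ lphi.
  apply: inj_r => a; rewrite ractD ractZ !eR (ract_linear _ k) !extRE.
  by rewrite lactD lactZ lphi.
- move=> m m'; apply: mult_ext => b.
    apply: inj_l => a; rewrite -[lact (extm m ** _) b]/(lact (extm m) (lact (extm m') b)).
    by rewrite !eL !extLE.
  apply: inj_r => a; rewrite -[ract b (extm m ** _)]/(ract (ract b (extm m)) (extm m')).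
  by rewrite !eR !extRE.
- move=> a; apply: mult_ext => b.
    by apply: inj_l => a'; rewrite eL extLE -phi_lactM.
  by apply: inj_r => a'; rewrite eR extRE -phi_ractM.
Qed.

End Extension.

Section DirectSum.
Context {K : fieldType} {I : choiceType}.

Record dsum (A : I -> nualgType K) : Type :=
  DSum { dval :> forall p, A p; dval_fin : finite_set [set p | dval p != 0] }.

Variable A : I -> nualgType K.

Lemma dsum_ext (a b : dsum A) : (forall p, a p = b p) -> a = b.
Proof.
case: a b => [a ha] [b hb] /= e.
have {}e : a = b by apply: functional_extensionality_dep.
by case: _ / e in hb *; congr DSum; exact: Prop_irrelevance.
Qed.

HB.instance Definition _ := gen_eqMixin (dsum A).
HB.instance Definition _ := gen_choiceMixin (dsum A).

Let fin_sub (a : dsum A) (f : forall p, A p) :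
  (forall p, a p = 0 -> f p = 0) -> finite_set [set p | f p != 0].
Proof.
move=> h; apply: (sub_finite_set _ (dval_fin a)) => p /=.
by apply: contra_neq; exact: h.
Qed.

Let fin0 : finite_set [set p | (fun p => 0 : A p) p != 0].
Proof. by apply: (sub_finite_set _ (@finite_set0 _)) => p /=; rewrite eqxx. Qed.

Let finD (a b : dsum A) : finite_set [set p | a p + b p != 0].
Proof.
apply: (@sub_finite_set _ _ ([set p | a p != 0] `|` [set p | b p != 0])).
  move=> p /= h; have [a0|/eqP an0] := pselect (a p = 0); last by left.
  by right; rewrite a0 add0r in h.
by rewrite finite_setU; split; exact: dval_fin.
Qed.

Let dzero := DSum fin0.
Let dadd (a b : dsum A) := DSum (finD a b).
Let dopp (a : dsum A) : dsum A :=
  @DSum A (fun p => - a p)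
    (fin_sub (fun p (e : a p = 0) => etrans (congr1 -%R e) (oppr0 _))).
Let dscale (k : K) (a : dsum A) : dsum A :=
  @DSum A (fun p => k *: a p)
    (fin_sub (fun p (e : a p = 0) => etrans (congr1 ( *:%R k) e) (scaler0 _ k))).
Let dmul (a b : dsum A) : dsum A :=
  @DSum A (fun p => a p ** b p)
    (fin_sub (fun p (e : a p = 0) => etrans (congr1 (amul^~ (b p)) e) (amul0l _))).

Let daddA : associative dadd.
Proof. by move=> a b c; apply: dsum_ext => p; exact: addrA. Qed.
Let daddC : commutative dadd.
Proof. by move=> a b; apply: dsum_ext => p; exact: addrC. Qed.
Let dadd0 : left_id dzero dadd.
Proof. by move=> a; apply: dsum_ext => p; exact: add0r. Qed.
Let daddN : left_inverse dzero dopp dadd.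
Proof. by move=> a; apply: dsum_ext => p; exact: addNr. Qed.

HB.instance Definition _ := GRing.isZmodule.Build (dsum A) daddA daddC dadd0 daddN.

Let dscaleA k l a : dscale k (dscale l a) = dscale (k * l) a.
Proof. by apply: dsum_ext => p; exact: scalerA. Qed.
Let dscale1 : left_id 1 dscale.
Proof. by move=> a; apply: dsum_ext => p; exact: scale1r. Qed.
Let dscaleDr : right_distributive dscale +%R.
Proof. by move=> k a b; apply: dsum_ext => p; exact: scalerDr. Qed.
Let dscaleDl a : {morph dscale^~ a : k l / k + l}.
Proof. by move=> k l; apply: dsum_ext => p; exact: scalerDl. Qed.

HB.instance Definition _ :=
  GRing.Zmodule_isLmodule.Build K (dsum A) dscaleA dscale1 dscaleDr dscaleDl.

Let dmulA : associative dmul.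
Proof. by move=> a b c; apply: dsum_ext => p; exact: amulA. Qed.
Let dmulDl : left_distributive dmul +%R.
Proof. by move=> a b c; apply: dsum_ext => p; exact: amulDl. Qed.
Let dmulDr : right_distributive dmul +%R.
Proof. by move=> a b c; apply: dsum_ext => p; exact: amulDr. Qed.
Let dmulZl k a b : dmul (k *: a) b = k *: dmul a b.
Proof. by apply: dsum_ext => p; exact: amulZl. Qed.
Let dmulZr k a b : dmul a (k *: b) = k *: dmul a b.
Proof. by apply: dsum_ext => p; exact: amulZr. Qed.

HB.instance Definition _ :=
  isNualg.Build K (dsum A) dmulA dmulDl dmulDr dmulZl dmulZr.

(* The family x as a multiplier of dsum A. *)
Let mfam_fin_l (x : forall p, mult (A p)) (a : dsum A) p :
  a p = 0 -> lact (x p) (a p) = 0.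
Proof. by move=> ->; exact: linear0' (lact_linear _). Qed.
Let mfam_fin_r (x : forall p, mult (A p)) (a : dsum A) p :
  a p = 0 -> ract (a p) (x p) = 0.
Proof. by move=> ->; exact: linear0' (ract_linear _). Qed.

Program Definition mfam (x : forall p, mult (A p)) : mult (dsum A) :=
  @mkmult K (dsum A)
    (fun a => @DSum A (fun p => lact (x p) (a p)) (fin_sub (mfam_fin_l x (a := a))))
    (fun a => @DSum A (fun p => ract (a p) (x p)) (fin_sub (mfam_fin_r x (a := a))))
    _ _ _ _ _.
Next Obligation. by move=> x k a b; apply: dsum_ext => p; exact: lact_linear. Qed.
Next Obligation. by move=> x k a b; apply: dsum_ext => p; exact: ract_linear. Qed.
Next Obligation. by move=> x a b; apply: dsum_ext => p; exact: lactM. Qed.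
Next Obligation. by move=> x a b; apply: dsum_ext => p; exact: ractM. Qed.
Next Obligation. by move=> x a b; apply: dsum_ext => p; exact: ract_lact. Qed.

Definition dproj p (a : dsum A) : A p := a p.

Definition dinj_fun p (a : A p) q : A q :=
  if pselect (p = q) is left e then ecast z (A z) e a else 0.

Lemma dinj_funE p (a : A p) : dinj_fun a p = a.
Proof.
rewrite /dinj_fun; case: pselect => // e.
by rewrite (eq_axiomK e).
Qed.

Lemma dinj_fun_neq p (a : A p) q : p <> q -> dinj_fun a q = 0.
Proof. by rewrite /dinj_fun; case: pselect. Qed.

Lemma dinj_fin p (a : A p) : finite_set [set q | dinj_fun a q != 0].
Proof.
apply: (sub_finite_set _ (finite_set1 p)) => q /=.
by have [e _|/dinj_fun_neq->] := pselect (p = q); rewrite ?eqxx.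
Qed.

Definition dinj p (a : A p) : dsum A := DSum (dinj_fin a).

Lemma dproj_hom p : alg_hom (@dproj p).
Proof. by split. Qed.

Lemma dinj_hom p : alg_hom (@dinj p).
Proof.
split=> [k a b|a b]; apply: dsum_ext => q.
  rewrite -[RHS]/(k *: dinj_fun a q + dinj_fun b q) /dinj /=.
  have [e|ne] := pselect (p = q); last by rewrite !dinj_fun_neq // scaler0 addr0.
  by case: _ / e; rewrite !dinj_funE.
rewrite -[RHS]/(dinj_fun a q ** dinj_fun b q) /dinj /=.
have [e|ne] := pselect (p = q); last by rewrite !dinj_fun_neq // amul0l.
by case: _ / e; rewrite !dinj_funE.
Qed.

Lemma dinj_amul p (a : A p) (b : dsum A) : dinj a ** b = dinj (a ** dproj p b).
Proof.
apply: dsum_ext => q; rewrite -[LHS]/(dinj_fun a q ** b q) /dinj /=.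
have [e|ne] := pselect (p = q); last by rewrite !dinj_fun_neq // amul0l.
by case: _ / e; rewrite !dinj_funE.
Qed.

Lemma amul_dinj p (a : A p) (b : dsum A) : b ** dinj a = dinj (dproj p b ** a).
Proof.
apply: dsum_ext => q; rewrite -[LHS]/(b q ** dinj_fun a q) /dinj /=.
have [e|ne] := pselect (p = q); last by rewrite !dinj_fun_neq // amul0r.
by case: _ / e; rewrite !dinj_funE.
Qed.

End DirectSum.

(* mfam2 views a family x(p, q) in M(A p (x) B q) as a multiplier of
   dsum A (x) dsum B; it is characterised by lact_mfam2 and ract_mfam2. *)
Section MultFamily.
Context {K : fieldType} {I J : choiceType}.
Variables (A : I -> nualgType K) (B : J -> nualgType K).

Definition dproj2 p q : tens (dsum A) (dsum B) -> tens (A p) (B q) :=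
  tmap (@dproj K I A p) (@dproj K J B q).
Definition dinj2 p q : tens (A p) (B q) -> tens (dsum A) (dsum B) :=
  tmap (@dinj K I A p) (@dinj K J B q).

Lemma dproj2_hom p q : alg_hom (@dproj2 p q).
Proof. by apply: tmap_hom; exact: dproj_hom. Qed.
Lemma dinj2_hom p q : alg_hom (@dinj2 p q).
Proof. by apply: tmap_hom; exact: dinj_hom. Qed.

Lemma dproj2_fin t : finite_set [set z : I * J | dproj2 z.1 z.2 t != 0].
Proof.
move: t; apply: tens_ind => [|a b|t t' ht ht'].
- apply: (sub_finite_set _ (@finite_set0 _)) => z /=.
  by rewrite (linear0' (dproj2_hom _ _).1) eqxx.
- apply: (sub_finite_set _ (finite_setX (dval_fin a) (dval_fin b))) => z /=.
  have [lp lq] := ((dproj_hom A z.1).1, (dproj_hom B z.2).1).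
  rewrite /dproj2 tmap_pure // => h; split.
    by apply: contra_neq h => h; rewrite /dproj h (linear0' ((tpure_bilinear _ _).1 _)).
  by apply: contra_neq h => h; rewrite /dproj h (linear0' ((tpure_bilinear _ _).2 _)).
- have hU := conj ht ht'; rewrite -finite_setU in hU.
  apply: (sub_finite_set _ hU) => z /= h; have [e|/eqP] := pselect (dproj2 z.1 z.2 t = 0); last by left.
  by right; rewrite (linearD' _ _ (dproj2_hom _ _).1) e add0r in h.
Qed.

Section Glue.
Variables (F : forall p q, tens (A p) (B q) -> tens (A p) (B q)).
Hypothesis lF : forall p q, linear (@F p q).

Definition dglue (t : tens (dsum A) (dsum B)) : tens (dsum A) (dsum B) :=
  \sum_(z \in [set: I * J]) dinj2 (F (dproj2 z.1 z.2 t)).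

Lemma dglueE (D : {fset I * J}) t :
  (forall z, z \notin D -> dproj2 z.1 z.2 t = 0) ->
  dglue t = \sum_(z <- D) dinj2 (F (dproj2 z.1 z.2 t)).
Proof.
move=> h; rewrite /dglue (fsbigTE D) // => z zD.
by rewrite h // (linear0' (@lF _ _)) (linear0' (dinj2_hom _ _).1).
Qed.

Lemma dsupp t : {D : {fset I * J} | forall z, z \notin D -> dproj2 z.1 z.2 t = 0}.
Proof.
exists (fset_set [set z : I * J | dproj2 z.1 z.2 t != 0]) => z.
rewrite in_fset_set; last exact: dproj2_fin.
by move=> h; apply: contrapT => /eqP h'; move/negP: h; apply; exact: mem_set.
Qed.

Lemma dglue_linear : linear dglue.
Proof.
move=> k s t; have [[D hD] [E hE]] := (dsupp s, dsupp t).
have lp z := (dproj2_hom z.1 z.2).1.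
pose DE := (D `|` E)%fset.
have hD' z : z \notin DE -> dproj2 z.1 z.2 s = 0.
  by rewrite in_fsetU negb_or => /andP[/hD].
have hE' z : z \notin DE -> dproj2 z.1 z.2 t = 0.
  by rewrite in_fsetU negb_or => /andP[_ /hE].
rewrite !(@dglueE DE) // => [|z zDE]; last first.
  by rewrite lp hD' // hE' // scaler0 addr0.
rewrite scaler_sumr -big_split; apply: eq_bigr => z _ /=.
by rewrite lp lF (dinj2_hom _ _).1.
Qed.

End Glue.

Lemma amul_suml (C : nualgType K) T (r : seq T) (H : T -> C) c :
  (\sum_(i <- r) H i) ** c = \sum_(i <- r) (H i ** c).
Proof. exact: (linear_sum' r H ((amul_bilinear C).1 c)). Qed.

Lemma amul_sumr (C : nualgType K) T (r : seq T) (H : T -> C) c :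
  c ** (\sum_(i <- r) H i) = \sum_(i <- r) (c ** H i).
Proof. exact: (linear_sum' r H ((amul_bilinear C).2 c)). Qed.

Lemma dinj2_amul p q (s : tens (A p) (B q)) t :
  dinj2 s ** t = dinj2 (s ** dproj2 p q t).
Proof.
have [li lp] := ((dinj2_hom p q).1, (dproj2_hom p q).1).
apply: (tens_eq_bilinear (f := fun s t => dinj2 s ** t)
  (g := fun s t => dinj2 (s ** dproj2 p q t))).
- exact: (bilin_comp (amul_bilinear _) li (@linear_id _ _) (@linear_id _ _)).
- exact: (bilin_comp (amul_bilinear _) (@linear_id _ _) lp li).
- move=> a b a' b'; rewrite /dinj2 /dproj2.
  rewrite !(tmap_pure (dinj_hom _ _).1 (dinj_hom _ _).1).
  rewrite !(tmap_pure (dproj_hom _ _).1 (dproj_hom _ _).1) !amul_pure.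
  by rewrite !(tmap_pure (dinj_hom _ _).1 (dinj_hom _ _).1) !dinj_amul.
Qed.

Lemma amul_dinj2 p q (s : tens (A p) (B q)) t :
  t ** dinj2 s = dinj2 (dproj2 p q t ** s).
Proof.
have [li lp] := ((dinj2_hom p q).1, (dproj2_hom p q).1).
apply: (tens_eq_bilinear (f := fun t s => t ** dinj2 s)
  (g := fun t s => dinj2 (dproj2 p q t ** s))).
- exact: (bilin_comp (amul_bilinear _) (@linear_id _ _) li (@linear_id _ _)).
- exact: (bilin_comp (amul_bilinear _) lp (@linear_id _ _) li).
- move=> a b a' b'; rewrite /dinj2 /dproj2.
  rewrite !(tmap_pure (dinj_hom _ _).1 (dinj_hom _ _).1).
  rewrite !(tmap_pure (dproj_hom _ _).1 (dproj_hom _ _).1) !amul_pure.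
  by rewrite !(tmap_pure (dinj_hom _ _).1 (dinj_hom _ _).1) !amul_dinj.
Qed.

Program Definition mfam2 (x : forall p q, mult (tens (A p) (B q))) :
    mult (tens (dsum A) (dsum B)) :=
  @mkmult K (tens (dsum A) (dsum B)) (dglue (fun p q t => lact (x p q) t))
    (dglue (fun p q t => ract t (x p q))) _ _ _ _ _.
Next Obligation. by move=> x; apply: dglue_linear => p q; exact: lact_linear. Qed.
Next Obligation. by move=> x; apply: dglue_linear => p q; exact: ract_linear. Qed.
Next Obligation.
move=> x s t; have [D hD] := dsupp s.
have lx p q := lact_linear (x p q).
rewrite !(dglueE lx (D := D)) // => [|z zD]; last first.
  by rewrite (dproj2_hom _ _).2 hD // amul0l.
rewrite amul_suml; apply: eq_bigr => z _.
by rewrite (dproj2_hom _ _).2 lactM dinj2_amul.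
Qed.
Next Obligation.
move=> x s t; have [D hD] := dsupp t.
have lx p q := ract_linear (x p q).
rewrite !(dglueE lx (D := D)) // => [|z zD]; last first.
  by rewrite (dproj2_hom _ _).2 hD // amul0r.
rewrite amul_sumr; apply: eq_bigr => z _.
by rewrite (dproj2_hom _ _).2 ractM amul_dinj2.
Qed.
Next Obligation.
move=> x s t; have [[D hD] [E hE]] := (dsupp s, dsupp t).
have [lx rx] := (fun p q => lact_linear (x p q), fun p q => ract_linear (x p q)).
pose DE := (D `|` E)%fset.
have hD' z : z \notin DE -> dproj2 z.1 z.2 s = 0.
  by rewrite in_fsetU negb_or => /andP[/hD].
have hE' z : z \notin DE -> dproj2 z.1 z.2 t = 0.
  by rewrite in_fsetU negb_or => /andP[_ /hE].
rewrite (dglueE lx hE') (dglueE rx hD') amul_suml amul_sumr.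
by apply: eq_bigr => z _; rewrite dinj2_amul amul_dinj2 ract_lact.
Qed.

Lemma dproj2K p q (s : tens (A p) (B q)) : dproj2 p q (dinj2 s) = s.
Proof.
move: s; apply: (tens_eq_linear (f := fun s => dproj2 p q (dinj2 s)) (g := id)) => //.
  by move=> k u v; rewrite (dinj2_hom _ _).1 (dproj2_hom _ _).1.
move=> a b; rewrite /dinj2 /dproj2.
rewrite (tmap_pure (dinj_hom _ _).1 (dinj_hom _ _).1).
by rewrite (tmap_pure (dproj_hom _ _).1 (dproj_hom _ _).1) /dproj /= !dinj_funE.
Qed.

Lemma dproj2_neq p q (s : tens (A p) (B q)) (z : I * J) :
  z \notin [fset (p, q)]%fset -> dproj2 z.1 z.2 (dinj2 s) = 0.
Proof.
rewrite in_fset1 => /eqP zn; move: s.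
apply: (tens_eq_linear (f := fun s => dproj2 z.1 z.2 (dinj2 s)) (g := fun=> 0)).
- by move=> k u v; rewrite (dinj2_hom _ _).1 (dproj2_hom _ _).1.
- by move=> k u v; rewrite scaler0 addr0.
move=> a b; rewrite /dinj2 /dproj2.
rewrite (tmap_pure (dinj_hom _ _).1 (dinj_hom _ _).1).
rewrite (tmap_pure (dproj_hom _ _).1 (dproj_hom _ _).1) /dproj /=.
have [e1|n1] := pselect (p = z.1); last first.
  by rewrite (dinj_fun_neq _ n1) (linear0' ((tpure_bilinear _ _).1 _)).
have [e2|n2] := pselect (q = z.2); last first.
  by rewrite (dinj_fun_neq _ n2) (linear0' ((tpure_bilinear _ _).2 _)).
by case: zn; rewrite e1 e2 -surjective_pairing.
Qed.

Lemma lact_mfam2 (x : forall p q, mult (tens (A p) (B q))) p q s :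
  lact (mfam2 x) (dinj2 s) = dinj2 (lact (x p q) s).
Proof.
have lx p' q' := lact_linear (x p' q').
by rewrite [LHS](dglueE lx (dproj2_neq s)) big_seq_fset1 /= dproj2K.
Qed.

Lemma ract_mfam2 (x : forall p q, mult (tens (A p) (B q))) p q s :
  ract (dinj2 s) (mfam2 x) = dinj2 (ract s (x p q)).
Proof.
have lx p' q' := ract_linear (x p' q').
by rewrite [LHS](dglueE lx (dproj2_neq s)) big_seq_fset1 /= dproj2K.
Qed.

End MultFamily.

Section MultiplierHopf.
Context {K : fieldType}.

(* Delta(x)(1 (x) b) and (a (x) 1)Delta(x), as multipliers *)
Definition coact_r (X A B : nualgType K) (Delta : X -> mult (tens A B))
  (x : X) (b : B) : mult (tens A B) := Delta x ** mtens mone (memb b).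
Definition coact_l (X A B : nualgType K) (Delta : X -> mult (tens A B))
  (a : A) (x : X) : mult (tens A B) := mtens (memb a) mone ** Delta x.

Definition covered (X A B : nualgType K) (Delta : X -> mult (tens A B)) : Prop :=
  (forall x b, range (@memb K (tens A B)) (coact_r Delta x b)) /\
  (forall a x, range (@memb K (tens A B)) (coact_l Delta a x)).

(* t in AB (x) C and s in A (x) BC are the elements Dl(x)(1 (x) c) and
   (a (x) 1)Dr(x), which exist by covered; the identity is
   (a (x) 1 (x) 1)(DAB (x) I)(t) = (I (x) DBC)(s)(1 (x) 1 (x) c). *)
Definition coassociative (X AB BC A B C : nualgType K)
    (Dl : X -> mult (tens AB C)) (DAB : AB -> mult (tens A B))
    (Dr : X -> mult (tens A BC)) (DBC : BC -> mult (tens B C)) : Prop :=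
  forall (a : A) (x : X) (c : C) (t : tens AB C) (s : tens A BC),
    memb t = coact_r Dl x c -> memb s = coact_l Dr a x ->
    massoc (mtens (mtens (memb a) mone) mone **
            tlift (fun d c' => mtens (DAB d) (memb c')) t) =
    tlift (fun a' e => mtens (memb a') (DBC e)) s **
      mtens mone (mtens mone (memb c)).

(* A (x) B is identified with its image in M(A (x) B), the range of memb. *)
Definition bijective_coact (X A B : nualgType K)
    (Delta : X -> mult (tens A B)) : Prop :=
  set_bij setT (range (@memb K (tens A B))) (tlift (coact_r Delta)) /\
  set_bij setT (range (@memb K (tens A B))) (tlift (coact_l Delta)).

Record multiplier_Hopf_algebra (A : nualgType K)
    (Delta : A -> mult (tens A A)) : Prop := {
  mha_nondeg : nondegenerate_product A;
  mha_hom : alg_hom Delta;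
  mha_covered : covered Delta;
  mha_coassoc : coassociative Delta Delta Delta Delta;
  mha_bij : bijective_coact Delta
}.

Record multiplier_Hopf_coalgebra (G : groupType) (A : G -> nualgType K)
    (Delta : forall p q, A (p * q)%g -> mult (tens (A p) (A q))) : Prop := {
  mhc_nondeg : forall p, nondegenerate_product (A p);
  mhc_hom : forall p q, alg_hom (Delta p q);
  mhc_covered : forall p q, covered (Delta p q);
  mhc_coassoc : forall p q r, coassociative (Delta (p * q)%g r) (Delta p q)
    (fun x => Delta p (q * r)%g (ecast g (A g) (esym (mulgA p q r)) x))
    (Delta q r);
  mhc_bij : forall p q, bijective_coact (Delta p q)
}.

Definition Delta_G (G : groupType) (A : G -> nualgType K)
    (Delta : forall p q, A (p * q)%g -> mult (tens (A p) (A q))) (a : dsum A) :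
    mult (tens (dsum A) (dsum A)) :=
  mfam2 (fun p q => Delta p q (a (p * q)%g)).

HB.instance Definition _ := isNualg.Build K K^o (@mulrA K) (@mulrDl K) (@mulrDr K)
  (fun k a b => esym (mulrA k a b)) (fun k a b => mulrCA a k b).

Definition scalar_family (G : groupType) : G -> nualgType K := fun=> (K^o : Type).
Definition fun_alg (G : groupType) : Type := dsum (@scalar_family G).
HB.instance Definition _ (G : groupType) := Nualg.on (fun_alg G).

Definition Delta_circ (G : groupType) (f : fun_alg G) :
    mult (tens (fun_alg G) (fun_alg G)) :=
  mfam2 (fun p q => (f (p * q)%g : K) *: mone).

Definition gamma_G (G : groupType) (A : G -> nualgType K) (f : fun_alg G) :
    mult (dsum A) :=
  mfam (fun p => (f p : K) *: mone).

Definition hom_tens (X Y A B : nualgType K) (f : X -> mult A) (g : Y -> mult B) :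
    tens X Y -> mult (tens A B) :=
  tlift (fun x y => mtens (f x) (g y)).

End MultiplierHopf.

(* Main.v *)
(* The images E p of the point masses of K(G) are orthogonal central idempotents
   of M(A), and A is the direct sum of the ideals A_p = E p A. By compat,
   Delta(E r) (E p (x) E q) is E p (x) E q when r = pq and 0 otherwise, so
   compressing Delta(a) to A_p (x) A_q sees only the component of a in A_pq;
   this compression is Delta_(p,q), and every axiom for it is the compression
   of the axiom for Delta. The compression of multipliers is multiplicative and
   multipliers of A (x) A are determined by their action because the product of
   A (x) A is again nondegenerate; this last fact needs enough linear functionals
   on A, but neither the counit nor A A = A. *)
Require Import Defs.
From HB Require Import structures.
From mathcomp Require Import all_boot all_algebra.
From mathcomp Require Import boolp classical_sets functions cardinality reals.
From mathcomp Require Import finmap complex.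

Set Implicit Arguments.
Unset Strict Implicit.
Unset Printing Implicit Defensive.

Import GRing.Theory.
Local Open Scope ring_scope.
Local Open Scope classical_set_scope.
#[local] Obligation Tactic := idtac.

(** * Separating functionals and nondegeneracy of tensor products *)

Section LinearAlgebra.
Context {K : fieldType}.
Implicit Types U V W : lmodType K.

Definition subspace V (S : set V) : Prop :=
  S 0 /\ forall (k : K) u v, S u -> S v -> S (k *: u + v).

Lemma subspaceZ V (S : set V) k u : subspace S -> S u -> S (k *: u).
Proof. by move=> [S0 SD] Su; rewrite -[_ *: _]addr0; exact: SD. Qed.

Lemma subspaceB V (S : set V) u v : subspace S -> S u -> S v -> S (u - v).
Proof. by move=> [_ SD] Su Sv; rewrite addrC -scaleN1r; exact: SD. Qed.

(** Zorn's lemma among the subspaces that contain [S] and avoid [v]. A maximal one is a hyperplane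
    complementary to the line of [v]: a vector [w] outside their sum could still be adjoined. *)
Lemma maximal_subspace V (S : set V) (v : V) : subspace S -> ~ S v ->
  exists M : set V, [/\ subspace M, S `<=` M, ~ M v &
    forall w, exists k : K, M (w - k *: v)].
Proof.
move=> sS Sv.
(* Joining [S] inside the predicate takes care of the empty chain: its union is [set0], which
   satisfies [P] because [S] does. *)
pose P (X : set V) := subspace (X `|` S) /\ ~ (X `|` S) v.
have [F FP totF|X [[sX nX] maxX]] := @Zorn_bigcup V P.
  have [X0|/existsNP[X0 /contrapT FX0]] := pselect (forall X, ~ F X).
    have -> : \bigcup_(X in F) X = set0.
      by rewrite -subset0 => x [X /X0].
    by rewrite /P set0U.
  have UE : (\bigcup_(X in F) X) `|` S = \bigcup_(X in F) (X `|` S).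
    apply/seteqP; split=> x.
      by move=> [[X FX Xx]|Sx]; [exists X => //; left|exists X0 => //; right].
    by move=> [X FX [Xx|Sx]]; [left; exists X|right].
  rewrite /P UE; split; last by move=> [X /FP[_ nX]].
  split; first by exists X0 => //; exact: (FP _ FX0).1.1.
  move=> k x y [X FX Xx] [Y FY Yy].
  have [XY|YX] := totF _ _ FX FY.
    exists Y => //; apply: (FP _ FY).1.2 => //.
    by case: Xx => [/XY|]; [left|right].
  exists X => //; apply: (FP _ FX).1.2 => //.
  by case: Yy => [/YX|]; [left|right].
exists (X `|` S); split=> // w.
apply: contrapT => /forallNP nw.
pose Y := [set x | exists k, (X `|` S) (x - k *: w)].
have sub x : (X `|` S) x -> Y x by move=> Xx; exists 0; rewrite scale0r subr0.
have YS : Y `|` S = Y by apply/seteqP; split=> [x []|x]; [|move=> Sx; apply: sub; right|left].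
have sY : subspace Y.
  split=> [|k x y [a Ya] [b Yb]]; first by apply: sub; exact: sX.1.
  exists (k * a + b); have := sX.2 k _ _ Ya Yb.
  by rewrite scalerBr scalerDl scalerA addrACA opprD.
have Yw : Y w by exists 1; rewrite scale1r subrr; exact: sX.1.
apply: (maxX Y).
  split=> [x Xx|YX]; first by apply: sub; left.
  by apply: (nw 0); rewrite scale0r subr0; left; exact: YX.
rewrite /P YS; split=> // -[k hk].
(* Here [v - k *: w] lies in the maximal subspace. The case [k = 0] contradicts [nX]; otherwise
   dividing by [- k] puts [w - k^-1 *: v] there, against the choice of [w]. *)
have [k0|k0] := eqVneq k 0; first by apply: nX; rewrite k0 scale0r subr0 in hk.
apply: (nw k^-1).
have := subspaceZ (- k^-1) sX hk.
by rewrite scalerBr scalerA scaleNr mulNr mulVf // scaleN1r opprK addrC.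
Qed.

(** The functional reads off the coefficient along [v] modulo the hyperplane [M]. This coefficient
    is unique, since two different ones would put a nonzero multiple of [v] in [M]; uniqueness
    yields linearity. *)
Lemma separating_functional V (S : set V) (v : V) : subspace S -> ~ S v ->
  exists f : V -> K^o, [/\ linear f, f v = 1 & forall s, S s -> f s = 0].
Proof.
move=> sS Sv; have [M [sM SM Mv hM]] := maximal_subspace sS Sv.
pose f w : K^o := projT1 (cid (hM w)).
have fP w : M (w - f w *: v) by rewrite /f; case: cid.
have f_uniq w k : M (w - k *: v) -> f w = k.
  move=> hk; apply/eqP; rewrite -subr_eq0; apply/eqP.
  apply: contrapT => /eqP d0; apply: Mv.
  have := subspaceZ (f w - k)^-1 sM (subspaceB sM hk (fP w)).
  by rewrite opprB [X in _ *: X]addrC subrKA -scalerBl scalerA mulVf // scale1r.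
exists f; split=> [k a b||s Ss].
- apply: f_uniq; have := sM.2 k _ _ (fP a) (fP b).
  by rewrite scalerBr scalerDl scalerA addrACA opprD.
- by apply: f_uniq; rewrite scale1r subrr; exact: sM.1.
- by apply: f_uniq; rewrite scale0r subr0; exact: SM.
Qed.

Lemma lspanP V (S : set V) : subspace (lspan S).
Proof.
split; first by exists 0, (fun=> 0), (fun=> 0); split; [case|rewrite big_ord0].
move=> k _ _ [n [a [u [Su ->]]]] [m [b [w [Sw ->]]]].
exists (n + m)%N, (fun i => match fintype.split i with inl i => k * a i | inr j => b j end),
  (fun i => match fintype.split i with inl i => u i | inr j => w j end).
split=> [i|]; first by case: fintype.split.
rewrite big_split_ord /= scaler_sumr; congr (_ + _); apply: eq_bigr => i _.
  by rewrite (unsplitK (inl _ i)) scalerA.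
by rewrite (unsplitK (inr _ i)).
Qed.

Lemma lspan_ind V (S P : set V) : subspace P -> S `<=` P -> lspan S `<=` P.
Proof.
move=> sP SP _ [n [k [u [Su ->]]]].
by elim/big_rec: _ => [|i v _ Pv]; [exact: sP.1|apply: sP.2 => //; exact: SP].
Qed.

Lemma lspan_sub V (S : set V) : S `<=` lspan S.
Proof.
move=> v Sv; exists 1%N, (fun=> 1), (fun=> v).
by split=> //; rewrite big_ord1 scale1r.
Qed.

Lemma pure0l U V (v : V) : (0 : U) ⊗ v = 0.
Proof. exact: linear0' ((tpure_bilinear _ _).1 _). Qed.

Lemma linear_comp U V W (f : V -> W) (g : U -> V) :
  linear f -> linear g -> linear (fun x => f (g x)).
Proof. by move=> lf lg k x y; rewrite lg lf. Qed.

(* Induction on the number of terms: the last right-hand factor is either a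
   combination of the others, or is separated from them by a functional. *)
Lemma tmap_joint_inj_l U V I (U' : I -> lmodType K) (f : forall i, U -> U' i) :
  (forall i, linear (f i)) -> (forall u, (forall i, f i u = 0) -> u = 0) ->
  forall x : tens U V, (forall i, tmap (f i) id x = 0) -> x = 0.
Proof.
move=> lf inj x.
have [n [u [v ->]]] : exists n (u : nat -> U) (v : nat -> V),
    x = \sum_(i < n) u i ⊗ v i.
  have [s ->] := tens_sum x; rewrite (big_nth (0, 0)) big_mkord.
  by exists (size s), (fun i => (nth (0, 0) s i).1), (fun i => (nth (0, 0) s i).2).
have lt i := tmap_linear (lf i) (@linear_id K V).
have bt W := tpure_bilinear W V.
elim: n u => [|n IHn] u; first by rewrite big_ord0.
pose S : set V := [set w | exists k : 'I_n -> K, w = \sum_(i < n) k i *: v i].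
have sS : subspace S.
  split; first by exists (fun=> 0); rewrite big1 // => i _; rewrite scale0r.
  move=> k _ _ [a ->] [b ->]; exists (fun i => k * a i + b i).
  rewrite scaler_sumr -big_split; apply: eq_bigr => i _ /=.
  by rewrite scalerDl scalerA.
rewrite big_ord_recr /=.
have [[k vn]|nSv] := pselect (S (v n)).
  (* The last term is absorbed into the others: each [k i *: v i] occurring in [v n] adds
     [k i *: u n] to the left factor [u i]. *)
  pose u' m := if insub m is Some i then u m + k i *: u n else u m.
  have -> : \sum_(i < n) u i ⊗ v i + u n ⊗ v n = \sum_(i < n) u' i ⊗ v i.
    rewrite vn (linear_sum' _ _ ((bt U).2 _)) -big_split.
    apply: eq_bigr => i _ /=; rewrite /u' valK.
    by rewrite (bilinDl (bt U)) (bilinZr (bt U)) (bilinZl (bt U)).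
  exact: IHn.
have [g [lg gv gS]] := separating_functional sS nSv.
move=> h.
have gvi i : (i < n)%N -> g (v i) = 0.
  move=> lin; apply: gS; exists (fun j => (j == Ordinal lin)%:R).
  rewrite (bigD1 (Ordinal lin)) //= eqxx scale1r big1 ?addr0 // => j /negbTE->.
  by rewrite scale0r.
(* Contracting the second factor with [g] kills the first [n] terms of [tmap (f i) id x] and leaves
   [f i (u n)]. *)
have un : u n = 0.
  apply: inj => i; have bg : is_bilinear (fun (w : U' i) z => (g z : K) *: w).
    split=> [z c w w'|w c z z'] /=.
      by rewrite scalerDr !scalerA mulrC.
    by rewrite lg scalerDl scalerA.
  have /(congr1 (tlift (fun w z => (g z : K) *: w))) := h i.
  rewrite (linearD' _ _ (lt i)) (linear_sum' _ _ (lt i)).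
  rewrite (linear0' (tlift_linear bg)) (linearD' _ _ (tlift_linear bg)).
  rewrite (linear_sum' _ _ (tlift_linear bg)) tmap_pure // tlift_pure // gv scale1r.
  rewrite big1 ?add0r // => j _.
  by rewrite tmap_pure // tlift_pure // gvi // scale0r.
by rewrite un pure0l addr0 in h *; exact: IHn.
Qed.

Definition tswap U V : tens U V -> tens V U := tlift (fun u v => v ⊗ u).

Lemma tswap_bilinear U V : is_bilinear (fun (u : U) (v : V) => v ⊗ u).
Proof. by split=> [v|u]; [exact: (tpure_bilinear _ _).2|exact: (tpure_bilinear _ _).1]. Qed.

Lemma tswap_linear U V : linear (@tswap U V).
Proof. exact: tlift_linear (@tswap_bilinear U V). Qed.

Lemma tswap_pure U V (u : U) (v : V) : tswap (u ⊗ v) = v ⊗ u.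
Proof. exact: tlift_pure (@tswap_bilinear U V). Qed.

Lemma tswapK U V : cancel (@tswap U V) (@tswap V U).
Proof.
apply: (tens_eq_linear (f := fun x => tswap (tswap x)) (g := id)) => //.
  exact: linear_comp (@tswap_linear V U) (@tswap_linear U V).
by move=> u v; rewrite !tswap_pure.
Qed.

(** The map [f i ⊗ g j] factors through [f i ⊗ id], and [tswap] reduces the second factor to the
    one-sided case. *)
Lemma tmap_joint_inj U V I J (U' : I -> lmodType K) (V' : J -> lmodType K)
    (f : forall i, U -> U' i) (g : forall j, V -> V' j) :
  (forall i, linear (f i)) -> (forall u, (forall i, f i u = 0) -> u = 0) ->
  (forall j, linear (g j)) -> (forall v, (forall j, g j v = 0) -> v = 0) ->
  forall x : tens U V, (forall i j, tmap (f i) (g j) x = 0) -> x = 0.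
Proof.
move=> lf injf lg injg x h.
apply: (tmap_joint_inj_l lf injf) => i.
apply: (can_inj (@tswapK _ _)); rewrite [RHS]linear0'; last exact: tswap_linear.
apply: (tmap_joint_inj_l lg injg) => j.
apply: (can_inj (@tswapK _ _)); rewrite [RHS]linear0'; last exact: tswap_linear.
rewrite -(h i j); move: x {h}.
apply: (tens_eq_linear (f := fun x => tswap (tmap (g j) id (tswap (tmap (f i) id x))))).
- apply: (linear_comp (@tswap_linear _ _)); apply: linear_comp.
    exact: tmap_linear.
  by apply: (linear_comp (@tswap_linear _ _)); exact: tmap_linear.
- exact: tmap_linear.
by move=> u v; rewrite !(tmap_pure, tswap_pure).
Qed.

Lemma amul_linear_l (A : nualgType K) (a : A) : linear (amul a).
Proof. exact: (amul_bilinear A).2. Qed.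
Lemma amul_linear_r (A : nualgType K) (a : A) : linear (amul^~ a).
Proof. exact: (amul_bilinear A).1. Qed.

(** Nondegeneracy is joint injectivity of the left, respectively right, multiplications, and
    multiplication by [a ⊗ b] is the tensor product of those by [a] and [b]. *)
Lemma tens_nondegenerate (A B : nualgType K) : nondegenerate_product A ->
  nondegenerate_product B -> nondegenerate_product (tens A B).
Proof.
move=> [lA rA] [lB rB]; split=> x h.
  apply: (tmap_joint_inj (@amul_linear_l A) lA (@amul_linear_l B) lB) => a b.
  rewrite -(h (a ⊗ b)); move: x {h}.
  apply: tens_eq_linear => [||u v]; rewrite ?amul_pure ?tmap_pure //.
  - by apply: tmap_linear; exact: amul_linear_l.
  - exact: amul_linear_l.
  - exact: amul_linear_l.
  - exact: amul_linear_l.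
apply: (tmap_joint_inj (@amul_linear_r A) rA (@amul_linear_r B) rB) => a b.
rewrite -(h (a ⊗ b)); move: x {h}.
apply: tens_eq_linear => [||u v]; rewrite ?amul_pure ?tmap_pure //.
- by apply: tmap_linear; exact: amul_linear_r.
- exact: amul_linear_r.
- exact: amul_linear_r.
- exact: amul_linear_r.
Qed.

End LinearAlgebra.

(** * Multipliers of tensor products and tensor products of homomorphisms *)

Section Multipliers.
Context {K : fieldType}.
Implicit Types X Y A B C : nualgType K.

Lemma linearB' (U V : lmodType K) (f : U -> V) u v :
  linear f -> f (u - v) = f u - f v.
Proof.
by move=> lf; rewrite -(scaleN1r v) (linearD' _ _ lf) (linearZ' _ _ lf) scaleN1r.
Qed.

Lemma amul_inj_l X (a b : X) : nondegenerate_product X ->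
  (forall c, a ** c = b ** c) -> a = b.
Proof.
move=> [_ nr] h; apply/eqP; rewrite -subr_eq0; apply/eqP; apply: nr => c.
by rewrite (linearB' _ _ (@amul_linear_r _ _ c)) h subrr.
Qed.

Lemma amul_inj_r X (a b : X) : nondegenerate_product X ->
  (forall c, c ** a = c ** b) -> a = b.
Proof.
move=> [nl _] h; apply/eqP; rewrite -subr_eq0; apply/eqP; apply: nl => c.
by rewrite (linearB' _ _ (@amul_linear_l _ _ c)) h subrr.
Qed.

Lemma lact_memb X (a b : X) : lact (memb a) b = a ** b. Proof. by []. Qed.
Lemma ract_memb X (a b : X) : ract a (memb b) = a ** b. Proof. by []. Qed.
Lemma lact_mone X (a : X) : lact mone a = a. Proof. by []. Qed.
Lemma lact_mmul X (x y : mult X) a : lact (x ** y) a = lact x (lact y a).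
Proof. by []. Qed.
Lemma ract_mmul X (x y : mult X) a : ract a (x ** y) = ract (ract a x) y.
Proof. by []. Qed.

Lemma memb_inj X : nondegenerate_product X -> injective (@memb K X).
Proof.
by move=> nX a b e; apply: (amul_inj_l nX) => c; rewrite -lact_memb e.
Qed.

Lemma mtens_bilinear A B : is_bilinear (@mtens K A B).
Proof.
split=> [y k x x'|x k y y'] /=; apply: mult_ext.
- apply: tens_eq_linear => [||a b]; try exact: lact_linear.
  rewrite lactD lactZ !lact_mtens lactD lactZ.
  by rewrite (bilinDl (tpure_bilinear _ _)) (bilinZl (tpure_bilinear _ _)).
- apply: tens_eq_linear => [||a b]; try exact: ract_linear.
  rewrite ractD ractZ !ract_mtens ractD ractZ.
  by rewrite (bilinDl (tpure_bilinear _ _)) (bilinZl (tpure_bilinear _ _)).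
- apply: tens_eq_linear => [||a b]; try exact: lact_linear.
  rewrite lactD lactZ !lact_mtens lactD lactZ.
  by rewrite (bilinDr (tpure_bilinear _ _)) (bilinZr (tpure_bilinear _ _)).
- apply: tens_eq_linear => [||a b]; try exact: ract_linear.
  rewrite ractD ractZ !ract_mtens ractD ractZ.
  by rewrite (bilinDr (tpure_bilinear _ _)) (bilinZr (tpure_bilinear _ _)).
Qed.

Lemma mtensM A B (x x' : mult A) (y y' : mult B) :
  mtens x y ** mtens x' y' = mtens (x ** x') (y ** y').
Proof.
apply: mult_ext.
  apply: tens_eq_linear => [||a b]; try exact: lact_linear.
  by rewrite lact_mmul !lact_mtens.
apply: tens_eq_linear => [||a b]; try exact: ract_linear.
by rewrite ract_mmul !ract_mtens.
Qed.

Lemma hom_tens_bilinear X Y A B (f : X -> mult A) (g : Y -> mult B) :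
  linear f -> linear g -> is_bilinear (fun x y => mtens (f x) (g y)).
Proof.
by move=> lf lg; apply: (bilin_comp (mtens_bilinear A B) lf lg (@linear_id _ _)).
Qed.

Lemma hom_tens_linear X Y A B (f : X -> mult A) (g : Y -> mult B) :
  linear f -> linear g -> linear (hom_tens f g).
Proof. by move=> lf lg; apply: tlift_linear; exact: hom_tens_bilinear. Qed.

Lemma hom_tens_pure X Y A B (f : X -> mult A) (g : Y -> mult B) x y :
  linear f -> linear g -> hom_tens f g (x ⊗ y) = mtens (f x) (g y).
Proof. by move=> lf lg; apply: tlift_pure; exact: hom_tens_bilinear. Qed.

Lemma hom_tens_hom X Y A B (f : X -> mult A) (g : Y -> mult B) :
  alg_hom f -> alg_hom g -> alg_hom (hom_tens f g).
Proof.
move=> [lf mf] [lg mg]; have lt := hom_tens_linear lf lg; split=> //.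
apply: (tens_eq_bilinear (f := fun s t => hom_tens f g (s ** t))
  (g := fun s t => hom_tens f g s ** hom_tens f g t)).
- exact: (bilin_comp (amul_bilinear _) (@linear_id _ _) (@linear_id _ _) lt).
- exact: (bilin_comp (amul_bilinear _) lt lt (@linear_id _ _)).
- by move=> u v u' v'; rewrite amul_pure !hom_tens_pure // mf mg mtensM.
Qed.

(** Two span inductions, one in each factor, since [⊗] is linear in each. *)
Lemma lspan_tens (U V : lmodType K) (S : set U) (T : set V) (P : set (tens U V)) :
  lspan S = setT -> lspan T = setT ->
  (forall u v, S u -> T v -> lspan P (u ⊗ v)) -> lspan P = setT.
Proof.
move=> hS hT h; have [bl br] := tpure_bilinear U V.
have sP := lspanP P.
have comp (W : lmodType K) (f : W -> tens U V) :
    linear f -> subspace [set w | lspan P (f w)].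
  by move=> lf; split=> [|k a b ha hb] /=; rewrite ?linear0' ?lf; [exact: sP.1|by []|exact: sP.2].
apply/seteqP; split=> // + _; apply: tens_ind => [|u v|x y hx hy].
- exact: sP.1.
- have : lspan S u by rewrite hS.
  apply: (lspan_ind (comp _ _ (bl v))) => {}u Su /=.
  have : lspan T v by rewrite hT.
  by apply: (lspan_ind (comp _ _ (br u))) => {}v Tv; exact: h.
- by rewrite -[x]scale1r; exact: sP.2.
Qed.

(** Through [mextP], this makes [mext (hom_tens f g)] a genuine extension when the target has
    nondegenerate product. *)
Lemma hom_tens_nondegenerate X Y A B (f : X -> mult A) (g : Y -> mult B) :
  alg_hom f -> alg_hom g -> nondegenerate_hom f -> nondegenerate_hom g ->
  nondegenerate_hom (hom_tens f g).
Proof.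
move=> [lf _] [lg _] [fl fr] [gl gr]; split.
  apply: (lspan_tens fl gl) => _ _ [x _ [a _ <-]] [y _ [b _ <-]].
  apply: lspan_sub; exists (x ⊗ y) => //; exists (a ⊗ b) => //.
  by rewrite hom_tens_pure // lact_mtens.
apply: (lspan_tens fr gr) => _ _ [x _ [a _ <-]] [y _ [b _ <-]].
apply: lspan_sub; exists (x ⊗ y) => //; exists (a ⊗ b) => //.
by rewrite hom_tens_pure // ract_mtens.
Qed.

(* i embeds Y as a two-sided ideal of X that is a direct summand with
   projection pr; then multipliers of X restrict to multipliers of Y. *)
Record corner X Y (i : Y -> X) (pr : X -> Y) : Prop := Corner {
  corner_inj : alg_hom i;
  corner_proj : alg_hom pr;
  cornerK : cancel i pr;
  corner_amul : forall y x, i y ** x = i (y ** pr x);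
  amul_corner : forall x y, x ** i y = i (pr x ** y)
}.

(** * Compression of multipliers to a corner *)

Section Restriction.
Variables (X Y : nualgType K) (i : Y -> X) (pr : X -> Y).
Hypotheses (cor : corner i pr).

Let li := (corner_inj cor).1.
Let lp := (corner_proj cor).1.
Let mi := (corner_inj cor).2.
Let mp := (corner_proj cor).2.

Program Definition restr (m : mult X) : mult Y :=
  @mkmult K Y (fun y => pr (lact m (i y))) (fun y => pr (ract (i y) m)) _ _ _ _ _.
Next Obligation. by move=> m k a b; rewrite li lact_linear lp. Qed.
Next Obligation. by move=> m k a b; rewrite li (ract_linear m) lp. Qed.
Next Obligation. by move=> m a b /=; rewrite mi lactM mp (cornerK cor). Qed.
Next Obligation. by move=> m a b /=; rewrite mi ractM mp (cornerK cor). Qed.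
Next Obligation.
move=> m a b /=; rewrite -[b in LHS](cornerK cor) -mp ract_lact mp.
by rewrite (cornerK cor).
Qed.

Lemma lact_restr m y : lact (restr m) y = pr (lact m (i y)). Proof. by []. Qed.
Lemma ract_restr m y : ract y (restr m) = pr (ract (i y) m). Proof. by []. Qed.

Lemma restr_linear : linear restr.
Proof.
move=> k x y; apply: mult_ext => a.
  by rewrite lactD lactZ !lact_restr lactD lactZ lp.
by rewrite ractD ractZ !ract_restr ractD ractZ lp.
Qed.

Hypothesis nX : nondegenerate_product X.

(** The projection [i \o pr] slides across products, hence by nondegeneracy commutes with every
    multiplier. This is what makes [restr] multiplicative. *)
Let e_l x y : i (pr x) ** y = x ** i (pr y).
Proof. by rewrite (corner_amul cor) (amul_corner cor). Qed.

Let lact_e m x : lact m (i (pr x)) = i (pr (lact m x)).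
Proof. by apply: (amul_inj_l nX) => u; rewrite -lactM !e_l lactM. Qed.

Let ract_e m x : ract (i (pr x)) m = i (pr (ract x m)).
Proof. by apply: (amul_inj_r nX) => u; rewrite -ractM -!e_l ractM. Qed.

Lemma lact_restr_proj m x : lact (restr m) (pr x) = pr (lact m x).
Proof. by rewrite lact_restr lact_e (cornerK cor). Qed.

Lemma ract_restr_proj m x : ract (pr x) (restr m) = pr (ract x m).
Proof. by rewrite ract_restr ract_e (cornerK cor). Qed.

Lemma restr_hom : alg_hom restr.
Proof.
split=> [|m n]; first exact: restr_linear.
apply: mult_ext => y.
  by rewrite lact_mmul !(lact_restr _ y) lact_mmul lact_restr_proj.
by rewrite ract_mmul !(ract_restr _ y) ract_mmul ract_restr_proj.
Qed.

Lemma restr_memb x : restr (memb x) = memb (pr x).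
Proof.
apply: mult_ext => y; rewrite ?lact_restr ?ract_restr ?lact_memb ?ract_memb mp;
  by rewrite (cornerK cor).
Qed.

Lemma restr_mone : restr mone = mone.
Proof. by apply: mult_ext => y; rewrite ?lact_restr ?ract_restr /= (cornerK cor). Qed.

End Restriction.

Lemma corner_tens X Y X' Y' (i : Y -> X) (pr : X -> Y) (i' : Y' -> X') (pr' : X' -> Y') :
  corner i pr -> corner i' pr' -> corner (tmap i i') (tmap pr pr').
Proof.
move=> c c'; have [[hi hp] [hi' hp']] :=
  ((corner_inj c, corner_proj c), (corner_inj c', corner_proj c')).
have [ti tp] := (tmap_hom hi hi', tmap_hom hp hp').
have [[li lp] [li' lp']] := ((hi.1, hp.1), (hi'.1, hp'.1)).
split=> //.
- apply: (tens_eq_linear (f := fun t => tmap pr pr' (tmap i i' t)) (g := id)) => //.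
    exact: (linear_comp tp.1 ti.1).
  by move=> u v; rewrite !tmap_pure // (cornerK c) (cornerK c').
- apply: (tens_eq_bilinear (f := fun y x => tmap i i' y ** x)
    (g := fun y x => tmap i i' (y ** tmap pr pr' x))).
  + exact: (bilin_comp (amul_bilinear _) ti.1 (@linear_id _ _) (@linear_id _ _)).
  + exact: (bilin_comp (amul_bilinear _) (@linear_id _ _) tp.1 ti.1).
  + move=> u v u' v'; rewrite !(tmap_pure, amul_pure) //.
    by rewrite (corner_amul c) (corner_amul c').
- apply: (tens_eq_bilinear (f := fun x y => x ** tmap i i' y)
    (g := fun x y => tmap i i' (tmap pr pr' x ** y))).
  + exact: (bilin_comp (amul_bilinear _) (@linear_id _ _) ti.1 (@linear_id _ _)).
  + exact: (bilin_comp (amul_bilinear _) tp.1 (@linear_id _ _) ti.1).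
  + move=> u v u' v'; rewrite !(tmap_pure, amul_pure) //.
    by rewrite (amul_corner c) (amul_corner c').
Qed.

Lemma restr_mtens X Y X' Y' (i : Y -> X) (pr : X -> Y) (i' : Y' -> X') (pr' : X' -> Y')
    (c : corner i pr) (c' : corner i' pr') m m' :
  restr (corner_tens c c') (mtens m m') = mtens (restr c m) (restr c' m').
Proof.
have [[li lp] [li' lp']] := (((corner_inj c).1, (corner_proj c).1),
  ((corner_inj c').1, (corner_proj c').1)).
apply: mult_ext.
  apply: tens_eq_linear => [||u v]; try exact: lact_linear.
  by rewrite lact_restr lact_mtens tmap_pure // lact_mtens tmap_pure.
apply: tens_eq_linear => [||u v]; try exact: ract_linear.
by rewrite ract_restr ract_mtens tmap_pure // ract_mtens tmap_pure.
Qed.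

(** Inclusions and projections are natural with respect to reassociation. Needed to compress the
    coassociativity identity, whose two sides start from different bracketings. *)
Lemma restr_massoc X Y X' Y' X'' Y'' (i : Y -> X) (pr : X -> Y)
    (i' : Y' -> X') (pr' : X' -> Y') (i'' : Y'' -> X'') (pr'' : X'' -> Y'')
    (c : corner i pr) (c' : corner i' pr') (c'' : corner i'' pr'') m :
  restr (corner_tens c (corner_tens c' c'')) (massoc m) =
  massoc (restr (corner_tens (corner_tens c c') c'') m).
Proof.
have [[li lp] [li' lp']] := (((corner_inj c).1, (corner_proj c).1),
  ((corner_inj c').1, (corner_proj c').1)).
have [li'' lp''] := ((corner_inj c'').1, (corner_proj c'').1).
have e1 t : tassocV (tmap i (tmap i' i'') t) = tmap (tmap i i') i'' (tassocV t).
  move: t; apply: tens3_eq_linear' => [||u v w].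
  - by apply: (linear_comp (@tassocV_linear _ _ _ _)); do !apply: tmap_linear => //.
  - by apply: (linear_comp _ (@tassocV_linear _ _ _ _)); do !apply: tmap_linear => //.
  have [l1 l2] := (tmap_linear li' li'', tmap_linear li li').
  by rewrite !(tmap_pure, tassocV_pure).
have e2 t : tmap pr (tmap pr' pr'') (tassoc t) = tassoc (tmap (tmap pr pr') pr'' t).
  move: t; apply: tens3_eq_linear => [||u v w].
  - by apply: (linear_comp _ (@tassoc_linear _ _ _ _)); do !apply: tmap_linear => //.
  - by apply: (linear_comp (@tassoc_linear _ _ _ _)); do !apply: tmap_linear => //.
  have [l1 l2] := (tmap_linear lp' lp'', tmap_linear lp lp').
  by rewrite !(tmap_pure, tassoc_pure).
apply: mult_ext => t.
  rewrite lact_restr -[lact (massoc m) _]/(tassoc (lact m (tassocV _))) e1 e2.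
  by [].
rewrite ract_restr -[ract _ (massoc m)]/(tassoc (ract (tassocV _) m)) e1 e2.
by [].
Qed.

(* An isomorphism is a corner, so restriction provides the extension of f. *)
Lemma mext_iso X Y (f : X -> Y) m n : nondegenerate_product X ->
  nondegenerate_product Y -> alg_hom f -> bijective f ->
  (forall x, f (lact m x) = lact n (f x)) ->
  (forall x, f (ract x m) = ract (f x) n) ->
  mext (fun x => memb (f x)) m = n.
Proof.
move=> nX nY hf [g fK gK] hl hr.
have hg : alg_hom g.
  split=> [k a b|a b]; apply: (can_inj fK); first by rewrite hf.1 !gK.
  by rewrite hf.2 !gK.
have c : corner g f.
  by split=> // [y x|x y]; rewrite hg.2 fK.
rewrite /mext; case: xgetP => [psi _ /= [hpsi epsi]|/(_ (restr c))]; last first.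
  by case; split=> [|a]; [exact: restr_hom|rewrite restr_memb].
(* Any extension [psi] satisfies [psi m ** memb (f x) = memb (f (lact m x))], which fixes its left
   action because [f] is onto; the right action is symmetric. *)
apply: mult_ext => y; rewrite -[y]gK.
  by apply: (memb_inj nY); rewrite -hl -epsi -!memb_lact hpsi.2 epsi.
by apply: (memb_inj nY); rewrite -hr -epsi -!memb_ract hpsi.2 epsi.
Qed.

End Multipliers.

(** * Direct sums of algebras *)

Section DirectSums.
Context {K : fieldType} {I : choiceType}.
Implicit Types A : I -> nualgType K.

Lemma dsum_sum A (a : dsum A) :
  exists2 s : seq I, uniq s & a = \sum_(p <- s) dinj (a p).
Proof.
exists (fset_set [set p | a p != 0]); first exact: fset_uniq.
apply: dsum_ext => q; rewrite -[RHS]/(dproj q _) (linear_sum' _ _ (dproj_hom A q).1).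
have [aq|aq] := eqVneq (a q) 0.
  rewrite aq big1 // => p _; rewrite /dproj /dinj /=.
  have [e|ne] := pselect (p = q); last exact: dinj_fun_neq.
  by case: _ / e in aq *; rewrite aq dinj_funE.
rewrite (big_rem q) /=; last first.
  by rewrite in_fset_set; [exact: mem_set|exact: dval_fin].
rewrite big_seq big1 ?addr0 => [|p].
  by rewrite /dproj /dinj /= dinj_funE.
by rewrite mem_rem_uniq ?fset_uniq // inE => /andP[/eqP ne _]; exact: dinj_fun_neq.
Qed.

Lemma corner_dsum A p : corner (@dinj K I A p) (@dproj K I A p).
Proof.
split; [exact: dinj_hom|exact: dproj_hom|by move=> a; exact: dinj_funE|..].
  exact: dinj_amul.
by move=> a b; exact: amul_dinj.
Qed.

Lemma dsum_nondegenerate A : (forall p, nondegenerate_product (A p)) ->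
  nondegenerate_product (dsum A).
Proof.
move=> nA; split=> b hb; apply: dsum_ext => p.
  apply: (nA p).1 => a.
  by have /(congr1 (dproj p)) := hb (dinj a); rewrite (dproj_hom A p).2 /dproj /= dinj_funE.
apply: (nA p).2 => a.
by have /(congr1 (dproj p)) := hb (dinj a); rewrite (dproj_hom A p).2 /dproj /= dinj_funE.
Qed.

End DirectSums.

(** * The ideal cut out by a central idempotent *)

Section FixedAlgebra.
Context {K : fieldType}.

(** For a central idempotent [e] this is the ideal [e A]; in this form membership is an equation and
    closure under products comes from [lactM]. *)
Definition fixed_by (A : nualgType K) (e : mult A) : {pred A} := fun a => lact e a == a.
Arguments fixed_by : clear implicits.

Record fixed (A : nualgType K) (e : mult A) : Type :=
  Fixed { fval : A; fvalP : fval \in fixed_by A e }.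

Variables (A : nualgType K) (e : mult A).

HB.instance Definition _ := [isSub for @fval A e].
HB.instance Definition _ := [Choice of fixed e by <:].

Lemma fixed_by_submod : submod_closed (fixed_by A e).
Proof.
split=> [|k a b]; rewrite !unfold_in ?(linear0' (lact_linear e)) //.
by move=> /eqP ha /eqP hb; rewrite (lact_linear e) ha hb.
Qed.

HB.instance Definition _ :=
  GRing.isSubmodClosed.Build _ _ (fixed_by A e) fixed_by_submod.
HB.instance Definition _ := [SubChoice_isSubLmodule of fixed e by <:].

Lemma lact_fval (a : fixed e) : lact e (fval a) = fval a.
Proof. by apply/eqP; have := fvalP a; rewrite unfold_in. Qed.

Lemma fixed_mul_subproof (a b : fixed e) : fval a ** fval b \in fixed_by A e.
Proof. by rewrite unfold_in lactM lact_fval. Qed.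

Definition fixed_mul (a b : fixed e) : fixed e := Fixed (fixed_mul_subproof a b).

Let mulA : associative fixed_mul.
Proof. by move=> a b c; apply: val_inj; exact: amulA. Qed.
Let mulDl : left_distributive fixed_mul +%R.
Proof. by move=> a b c; apply: val_inj; exact: amulDl. Qed.
Let mulDr : right_distributive fixed_mul +%R.
Proof. by move=> a b c; apply: val_inj; exact: amulDr. Qed.
Let mulZl k a b : fixed_mul (k *: a) b = k *: fixed_mul a b.
Proof. by apply: val_inj; exact: amulZl. Qed.
Let mulZr k a b : fixed_mul a (k *: b) = k *: fixed_mul a b.
Proof. by apply: val_inj; exact: amulZr. Qed.

HB.instance Definition _ := isNualg.Build K (fixed e) mulA mulDl mulDr mulZl mulZr.

Hypotheses (idem : e ** e = e) (central : forall a, lact e a = ract a e).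

Lemma fproj_subproof a : lact e a \in fixed_by A e.
Proof. by rewrite unfold_in -lact_mmul idem. Qed.

Definition fproj (a : A) : fixed e := Fixed (fproj_subproof a).

(** If [e a = a], centrality gives [a b = (a e) b = a (e b)], so products with the ideal see only
    projections. *)
Lemma corner_fixed : corner (@fval A e) fproj.
Proof.
split=> //.
- split=> [k a b|a b]; apply: val_inj; first exact: lact_linear.
  by rewrite /= -lactM ![lact e (_ ** _)]central !ractM -!central -lact_mmul idem.
- by move=> a; apply: val_inj; exact: lact_fval.
- by move=> a b; rewrite /= -[fval a in LHS]lact_fval central ract_lact.
- by move=> a b; rewrite /= central ract_lact lact_fval.
Qed.

End FixedAlgebra.

(** * The central idempotents [E p] and the compatibility condition *)

Section Grading.
Context {K : fieldType} {G : groupType}.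

Definition delta (p : G) : fun_alg (K := K) G :=
  @dinj K G (@scalar_family K G) p (1 : K^o).

Lemma mul_delta (f : fun_alg (K := K) G) p : f ** delta p = (f p : K) *: delta p.
Proof.
rewrite /delta amul_dinj -(linearZ' _ _ (@dinj_hom K G (@scalar_family K G) p).1).
by congr dinj.
Qed.

Lemma deltaE p q : delta p q = (p == q)%:R :> K.
Proof.
rewrite /delta /=; have [<-|/eqP ne] := eqVneq p q; first by rewrite dinj_funE.
by rewrite dinj_fun_neq.
Qed.

Variables (A : nualgType K) (Delta : A -> mult (tens A A)).
Variable gamma : fun_alg (K := K) G -> mult A.
Hypotheses (hA : multiplier_Hopf_algebra Delta) (hgamma : alg_hom gamma).
Hypothesis ndgamma : nondegenerate_hom gamma.
Hypothesis central : forall (f : fun_alg (K := K) G) (x : mult A),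
  gamma f ** x = x ** gamma f.
Hypothesis compat : forall f : fun_alg (K := K) G,
  mext Delta (gamma f) = mext (hom_tens gamma gamma) (Delta_circ f).

Let nA := mha_nondeg hA.
Let nAA := tens_nondegenerate nA nA.
Let lD := (mha_hom hA).1.

Let E p := gamma (delta p).

Lemma gamma_delta f p : gamma f ** E p = (f p : K) *: E p.
Proof. by rewrite -hgamma.2 mul_delta (linearZ' _ _ hgamma.1). Qed.

Lemma gamma_deltaM p q : E p ** E q = (p == q)%:R *: E q.
Proof. by rewrite gamma_delta deltaE. Qed.

Lemma gamma_delta_idem p : E p ** E p = E p.
Proof. by rewrite gamma_deltaM eqxx scale1r. Qed.

Lemma lact_ract_gamma f a : lact (gamma f) a = ract a (gamma f).
Proof. by apply: (memb_inj nA); rewrite -memb_lact -memb_ract central. Qed.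

Let Gam := mext (hom_tens gamma gamma).

(** On [delta p ⊗ delta q] the multiplier [Delta_circ f] acts as a scalar, and the multiplicative
    extension [Gam] carries this over to [E p ⊗ E q]. *)
Lemma mext_hom_tens_delta f p q :
  Gam (Delta_circ f) ** mtens (E p) (E q) = (f (p * q)%g : K) *: mtens (E p) (E q).
Proof.
have ht := hom_tens_hom hgamma hgamma.
have nt := hom_tens_nondegenerate hgamma hgamma ndgamma ndgamma.
have [[lG mG] eG] := mextP nAA ht nt.
rewrite -(hom_tens_pure _ _ hgamma.1 hgamma.1) -[hom_tens _ _ _ in LHS]eG.
rewrite -mG memb_lact.
have -> : delta p ⊗ delta q = dinj2 ((1 : @scalar_family K G p) ⊗ (1 : @scalar_family K G q)).
  by rewrite /dinj2 tmap_pure //; exact: (dinj_hom _ _).1.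
rewrite lact_mfam2 lactZ lact_mone (linearZ' _ _ (dinj2_hom _ _ _ _).1).
by rewrite eG (linearZ' _ _ ht.1).
Qed.

Lemma gamma_sum f : exists s : seq G, gamma f = \sum_(p <- s) (f p : K) *: E p.
Proof.
have [s _ fE] := dsum_sum f; exists s.
rewrite [in LHS]fE (linear_sum' _ _ hgamma.1); apply: eq_bigr => p _.
rewrite -(linearZ' _ _ hgamma.1); congr gamma.
rewrite /delta -(linearZ' _ _ (@dinj_hom K G (@scalar_family K G) p).1).
by congr dinj; rewrite /GRing.scale /= mulr1.
Qed.

(** Each [gamma f] is a finite combination of the [E p], so the nondegeneracy of [gamma] passes to
    these idempotents. *)
Lemma lspan_gamma_delta :
  lspan [set lact (E p) a | p in [set: G] & a in [set: A]] = setT.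
Proof.
apply/seteqP; split=> // b _.
have : lspan [set lact (gamma f) a | f in setT & a in setT] b by rewrite ndgamma.1.
apply: (lspan_ind (lspanP _)) => _ [f _ [a _ <-]].
have [s ->] := gamma_sum f.
rewrite (linear_sum' (f := (@lact K A)^~ a)) //.
elim/big_rec: _ => [|p c _ hc]; first exact: (lspanP _).1.
by rewrite lactZ; apply: (lspanP _).2 => //; apply: lspan_sub; exists p => //; exists a.
Qed.

(* If Delta had no extension, then mext Delta would be 0 and compat would force
   A (x) A = 0; but then 0 is an extension. *)
Lemma mext_DeltaP : alg_hom (mext Delta) /\ forall a, mext Delta (memb a) = Delta a.
Proof.
have [[psi hpsi]|nex] := pselect (exists psi : mult A -> mult (tens A A),
    alg_hom psi /\ forall a, psi (memb a) = Delta a).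
  exact: (xgetI (fun=> 0) (hpsi : [set psi | _ /\ _] psi)).
have e0 x : mext Delta x = 0.
  by rewrite /mext; case: xgetP => // psi _ hpsi; case: nex; exists psi.
(* At the point mass of [p * q] the scalar is 1, while the left side of [compat] vanishes. *)
have z p q : mtens (E p) (E q) = 0.
  have := mext_hom_tens_delta (delta (p * q)%g) p q.
  by rewrite /Gam -compat e0 amul0l deltaE eqxx scale1r => <-.
have AA0 (t : tens A A) : t = 0.
  have : lspan [set (0 : tens A A)] t.
    rewrite (lspan_tens lspan_gamma_delta lspan_gamma_delta) //.
    move=> _ _ [p _ [a _ <-]] [q _ [b _ <-]]; apply: lspan_sub => /=.
    by rewrite -lact_mtens z.
  apply: (lspan_ind (P := [set x | x = 0])) => //.
  by split=> // k u v /= -> ->; rewrite scaler0 addr0.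
have M0 (x : mult (tens A A)) : x = 0 by apply: mult_ext => t; exact: etrans (AA0 _) (esym (AA0 _)).
by case: nex; exists (fun=> 0); split=> [|a]; [split=> [k x y|x y]|]; exact: esym (M0 _).
Qed.

(** * The components and their compressed comultiplications *)

Definition component (p : G) : nualgType K := fixed (E p).
Definition cproj p : A -> component p := fproj (gamma_delta_idem p).
Definition cinj p : component p -> A := @fval K A (E p).

Lemma corner_component p : corner (@cinj p) (cproj p).
Proof. exact: (corner_fixed _ (lact_ract_gamma (delta p))). Qed.

Definition corner2 p q := corner_tens (corner_component p) (corner_component q).

Definition component_Delta p q (x : component (p * q)%g) :
  mult (tens (component p) (component q)) := restr (corner2 p q) (Delta (cinj x)).

Let li p := (corner_inj (corner_component p)).1.
Let lp p := (corner_proj (corner_component p)).1.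

(** By the corner identities, multiplying an element of the component by [a] amounts to multiplying
    it by [cproj p a]; so annihilating the component means annihilating [A]. *)
Lemma component_nondegenerate p : nondegenerate_product (component p).
Proof.
have cor := corner_component p; split=> b hb; rewrite -(cornerK cor b).
  rewrite -[RHS](linear0' (@lp p)); congr cproj; apply: nA.1 => a.
  by rewrite (amul_corner cor) hb (linear0' (@li p)).
rewrite -[RHS](linear0' (@lp p)); congr cproj; apply: nA.2 => a.
by rewrite (corner_amul cor) hb (linear0' (@li p)).
Qed.

Let nB := component_nondegenerate.
Let nBB p q := tens_nondegenerate (nB p) (nB q).

Lemma cinj_cproj p a : cinj (cproj p a) = lact (E p) a. Proof. by []. Qed.

Lemma lact_cinj p (x : component p) : lact (E p) (cinj x) = cinj x.
Proof. exact: lact_fval. Qed.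

Lemma cproj_cinj_neq p q (x : component p) : q != p -> cproj q (cinj x) = 0.
Proof.
move=> ne; apply: val_inj; rewrite /= -(lact_cinj x) -lact_mmul.
by rewrite gamma_deltaM (negbTE ne) scale0r.
Qed.

(** Since [a (E p c) = (E p a) c], such an element annihilates the [lact (E p) c], which span
    [A]. *)
Lemma cproj_joint_inj a : (forall p, cproj p a = 0) -> a = 0.
Proof.
move=> h; apply: nA.2 => b.
have : lspan [set lact (E p) a | p in [set: G] & a in [set: A]] b.
  by rewrite lspan_gamma_delta.
apply: (lspan_ind (P := [set b | a ** b = 0])).
  split=> [|k u v /= hu hv]; first exact: amul0r.
  by rewrite (amul_linear_l a) hu hv scaler0 addr0.
move=> _ [p _ [c _ <-]] /=.
by rewrite -ract_lact -lact_ract_gamma -cinj_cproj h amul0l.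
Qed.

Lemma restr_gamma_delta p : restr (corner_component p) (E p) = mone.
Proof.
by apply: mult_ext => x; rewrite ?lact_restr ?ract_restr -?lact_ract_gamma
  lact_cinj (cornerK (corner_component p)).
Qed.

Lemma mtens_mone (X Y : nualgType K) : mtens mone mone = mone :> mult (tens X Y).
Proof.
apply: mult_ext.
  by apply: tens_eq_linear => [||u v]; rewrite ?lact_mtens //; exact: lact_linear.
by apply: tens_eq_linear => [||u v]; rewrite ?ract_mtens //; exact: ract_linear.
Qed.

(** The multiplier [E p ⊗ E q] compresses to the unit of the block, so it may be inserted; [compat]
    then yields the scalar. *)
Lemma restr_mext_Delta p q f :
  restr (corner2 p q) (mext Delta (gamma f)) = (f (p * q)%g : K) *: mone.
Proof.
have [lr mr] := restr_hom (corner2 p q) nAA.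
have e1 : restr (corner2 p q) (mtens (E p) (E q)) = mone.
  by rewrite restr_mtens !restr_gamma_delta mtens_mone.
have e2 x : x ** mone = x :> mult (tens (component p) (component q)).
  exact: mult_ext.
rewrite -[LHS]e2 -[in LHS]e1 -mr compat mext_hom_tens_delta.
by rewrite (linearZ' _ _ lr) e1.
Qed.

(** The extension of [Delta] splits off the factor of [gamma f], whose compression is scalar. With
    [f] a point mass, this shows that the block at [p], [q] of [Delta a] sees only the component of
    [a] at [p * q]. *)
Lemma restr_Delta_gamma p q f a :
  restr (corner2 p q) (Delta (lact (gamma f) a)) =
  (f (p * q)%g : K) *: restr (corner2 p q) (Delta a).
Proof.
have [[_ mm] em] := mext_DeltaP.
rewrite -!em -memb_lact mm (restr_hom (corner2 p q) nAA).2 restr_mext_Delta.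
by rewrite amulZl; congr (_ *: _); apply: mult_ext.
Qed.

Lemma component_DeltaE p q a :
  component_Delta (cproj (p * q)%g a) = restr (corner2 p q) (Delta a).
Proof. by rewrite /component_Delta cinj_cproj restr_Delta_gamma deltaE eqxx scale1r. Qed.

Lemma restr_Delta_neq p q r (x : component r) : r != (p * q)%g ->
  restr (corner2 p q) (Delta (cinj x)) = 0.
Proof.
by move=> ne; rewrite -lact_cinj restr_Delta_gamma deltaE (negbTE ne) scale0r.
Qed.

Lemma component_Delta_hom p q : alg_hom (@component_Delta p q).
Proof.
have [lr mr] := restr_hom (corner2 p q) nAA.
split=> [k x y|x y]; rewrite /component_Delta.
  by rewrite li lD lr.
by rewrite (corner_inj (corner_component _)).2 (mha_hom hA).2 mr.
Qed.

Lemma restr_coact_r p q a b : restr (corner2 p q) (coact_r Delta a b) =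
  restr (corner2 p q) (Delta a) ** mtens mone (memb (cproj q b)).
Proof.
by rewrite (restr_hom (corner2 p q) nAA).2 restr_mtens restr_mone restr_memb.
Qed.

Lemma restr_coact_l p q a b : restr (corner2 p q) (coact_l Delta a b) =
  mtens (memb (cproj p a)) mone ** restr (corner2 p q) (Delta b).
Proof.
by rewrite (restr_hom (corner2 p q) nAA).2 restr_mtens restr_mone restr_memb.
Qed.

(** * Covering and bijectivity for the components *)

Lemma coact_r_bilinear (X Y Z : nualgType K) (D : X -> mult (tens Y Z)) :
  linear D -> is_bilinear (coact_r D).
Proof.
move=> ld; apply: (bilin_comp (amul_bilinear _) ld _ (@linear_id _ _)).
exact: linear_comp ((mtens_bilinear Y Z).2 _) (memb_hom Z).1.
Qed.

Lemma coact_l_bilinear (X Y Z : nualgType K) (D : X -> mult (tens Y Z)) :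
  linear D -> is_bilinear (coact_l D).
Proof.
move=> ld; apply: (bilin_comp (amul_bilinear _) _ ld (@linear_id _ _)).
exact: linear_comp ((mtens_bilinear Y Z).1 _) (memb_hom Y).1.
Qed.

Let cpr (z : G * G) := tmap (cproj z.1) (cproj z.2).

Lemma cproj2_joint_inj (t : tens A A) : (forall z, cpr z t = 0) -> t = 0.
Proof.
move=> h; apply: (tmap_joint_inj lp cproj_joint_inj lp cproj_joint_inj) => p q.
exact: (h (p, q)).
Qed.

(* T maps Z onto A (x) A and S is its compression to the (p, q) block; as T
   maps the block W of Z into that block only, S inherits the bijectivity of T. *)
Lemma compression_bij (Z W : lmodType K) (j : W -> Z) (pr : Z -> W) p q
    (T : Z -> mult (tens A A))
    (S : W -> mult (tens (component p) (component q))) :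
  linear T -> linear S -> linear j -> linear pr -> cancel j pr ->
  (forall z, S (pr z) = restr (corner2 p q) (T z)) ->
  (forall z w, z != (p, q) -> restr (corner2 z.1 z.2) (T (j w)) = 0) ->
  set_bij setT (range (@memb K (tens A A))) T ->
  set_bij setT (range (@memb K (tens (component p) (component q)))) S.
Proof.
move=> lT lS lj lpr jK SE T0 [Tim Tinj Tsurj].
have TjE w : exists2 u, memb u = T (j w) & S w = memb (cpr (p, q) u).
  have [u _ uE] := Tim (j w) I; exists u => //.
  by rewrite -[w in LHS]jK SE -uE restr_memb.
split=> [w _|w w' _ _ e|_ [s _ <-]].
- by have [u _ ->] := TjE w; exists (cpr (p, q) u).
- apply/eqP; rewrite -subr_eq0; apply/eqP.
  have {e} : S (w - w') = 0 by rewrite (linearB' _ _ lS) e subrr.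
  move: (w - w') => {w'}w Sw; have [u uE SwE] := TjE w.
  (* Every block of [u] vanishes: the one at [p], [q] because [S w = 0], the others by [T0]. *)
  have u0 : u = 0.
    apply: cproj2_joint_inj => z; apply: (memb_inj (nBB z.1 z.2)).
    rewrite [RHS](linear0' (memb_hom _).1).
    have [->|zn] := eqVneq z (p, q); first by rewrite -SwE.
    by rewrite -(T0 z w zn) -uE restr_memb.
  rewrite -[w]jK -[RHS](linear0' lpr); congr pr.
  apply: Tinj; [exact: mem_set|exact: mem_set|].
  by rewrite (linear0' lT) -[LHS]uE u0 (linear0' (memb_hom _).1).
have [z _ zE] := Tsurj (memb (tmap (@cinj p) (@cinj q) s)) (imageT _ _).
exists (pr z) => //.
by rewrite SE zE restr_memb (cornerK (corner2 p q)).
Qed.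

Lemma component_bijective_coact p q : bijective_coact (@component_Delta p q).
Proof.
have ldD := (component_Delta_hom p q).1.
have [br bl] := (coact_r_bilinear lD, coact_l_bilinear lD).
have [br' bl'] := (coact_r_bilinear ldD, coact_l_bilinear ldD).
have lr p q := (restr_hom (corner2 p q) nAA).1.
split.
- have c := corner2 (p * q)%g q.
  apply: (compression_bij _ _ (corner_inj c).1 (corner_proj c).1 (cornerK c)
    _ _ (mha_bij hA).1).
  + exact: tlift_linear.
  + exact: tlift_linear.
  + apply: tens_eq_linear => [||a b].
    * exact: linear_comp (tlift_linear br') (corner_proj c).1.
    * exact: linear_comp (lr _ _) (tlift_linear br).
    by rewrite (tmap_pure (@lp _) (@lp _)) !tlift_pure // restr_coact_r -component_DeltaE.
  + move=> [p' q'] w /= ne; move: w; apply: tens_eq_linear => [||x y].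
    * apply: (linear_comp (lr _ _)).
      exact: linear_comp (tlift_linear br) (corner_inj c).1.
    * by move=> k u v; rewrite scaler0 addr0.
    rewrite (tmap_pure (@li _) (@li _)) tlift_pure // restr_coact_r.
    (* Outside the block, either [q'] differs from [q] and the factor from [y] projects to 0, or
       [p'] differs from [p] and right cancellation in [G] makes [p' * q] differ from [p * q], so
       the factor from [x] vanishes. *)
    have [e|nq] := eqVneq q' q; last first.
      rewrite cproj_cinj_neq // (linear0' (memb_hom _).1).
      by rewrite (linear0' ((mtens_bilinear _ _).2 _)) amul0r.
    rewrite restr_Delta_neq ?amul0l // e; apply: contra ne => /eqP/mulIg ->.
    by rewrite e.
- have c := corner2 p (p * q)%g.
  apply: (compression_bij _ _ (corner_inj c).1 (corner_proj c).1 (cornerK c)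
    _ _ (mha_bij hA).2).
  + exact: tlift_linear.
  + exact: tlift_linear.
  + apply: tens_eq_linear => [||a b].
    * exact: linear_comp (tlift_linear bl') (corner_proj c).1.
    * exact: linear_comp (lr _ _) (tlift_linear bl).
    by rewrite (tmap_pure (@lp _) (@lp _)) !tlift_pure // restr_coact_l -component_DeltaE.
  + move=> [p' q'] w /= ne; move: w; apply: tens_eq_linear => [||x y].
    * apply: (linear_comp (lr _ _)).
      exact: linear_comp (tlift_linear bl) (corner_inj c).1.
    * by move=> k u v; rewrite scaler0 addr0.
    rewrite (tmap_pure (@li _) (@li _)) tlift_pure // restr_coact_l.
    have [e|np] := eqVneq p' p; last first.
      rewrite cproj_cinj_neq // (linear0' (memb_hom _).1).
      by rewrite (linear0' ((mtens_bilinear _ _).1 _)) amul0l.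
    rewrite restr_Delta_neq ?amul0r // e; apply: contra ne => /eqP/mulgI ->.
    by rewrite e.
Qed.

(** Contained in the bijectivity, whose maps take values in the range of [memb]: evaluate at pure
    tensors. *)
Lemma component_covered p q : covered (@component_Delta p q).
Proof.
have ldD := (component_Delta_hom p q).1.
have [[h1 _ _] [h2 _ _]] := component_bijective_coact p q.
split=> [x b|a x].
  have := h1 (x ⊗ b) I; rewrite tlift_pure //; exact: coact_r_bilinear.
have := h2 (a ⊗ x) I; rewrite tlift_pure //; exact: coact_l_bilinear.
Qed.

(** * Coassociativity for the components *)

Lemma cinj_ecast p q (e : p = q) (x : component p) :
  cinj (ecast r (component r) e x) = cinj x.
Proof. by case: _ / e. Qed.

Lemma restr_hom_tens (X Y X' Y' Z Z' Q Q' : nualgType K)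
    (f : X -> mult Y) (f' : X' -> mult Y') (g : Z -> mult Q) (g' : Z' -> mult Q')
    (h : X -> X') (k : Z -> Z') (i : Y' -> Y) (pr : Y -> Y')
    (i' : Q' -> Q) (pr' : Q -> Q') (c : corner i pr) (c' : corner i' pr') :
  nondegenerate_product Y -> nondegenerate_product Q ->
  linear f -> linear f' -> linear g -> linear g' -> linear h -> linear k ->
  (forall x, restr c (f x) = f' (h x)) -> (forall z, restr c' (g z) = g' (k z)) ->
  forall t, restr (corner_tens c c') (hom_tens f g t) = hom_tens f' g' (tmap h k t).
Proof.
move=> nY nQ lf lf' lg lg' lh lk ef eg.
have lr := (restr_hom (corner_tens c c') (tens_nondegenerate nY nQ)).1.
apply: tens_eq_linear => [||x z].
- exact: (linear_comp lr (hom_tens_linear lf lg)).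
- exact: (linear_comp (hom_tens_linear lf' lg') (tmap_linear lh lk)).
by rewrite hom_tens_pure // restr_mtens ef eg tmap_pure // hom_tens_pure.
Qed.

Lemma component_coassociative p q r :
  coassociative (@component_Delta (p * q)%g r) (@component_Delta p q)
    (fun x => @component_Delta p (q * r)%g (ecast g (component g) (esym (mulgA p q r)) x))
    (@component_Delta q r).
Proof.
move=> a x c t s ht hs.
(* The covered elements [u] and [v] of [A ⊗ A] project to [t] and [s] by injectivity of [memb], so
   the identity sought is the compression of the one for [u] and [v]. *)
have [u _ uE] := (mha_covered hA).1 (cinj x) (cinj c).
have [v _ vE] := (mha_covered hA).2 (cinj a) (cinj x).
have cK p := cornerK (corner_component p).
have tE : t = tmap (cproj (p * q)%g) (cproj r) u.
  apply: (memb_inj (nBB _ _)).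
  by rewrite ht -(restr_memb (corner2 _ _)) uE restr_coact_r cK.
(* The components all embed in the same [A], where the cast along associativity of [G]
   disappears. *)
have sE : s = tmap (cproj p) (cproj (q * r)%g) v.
  apply: (memb_inj (nBB _ _)); rewrite hs -(restr_memb (corner2 _ _)) vE.
  by rewrite restr_coact_l cK /coact_l /component_Delta cinj_ecast.
pose cp := corner_component p; pose cq := corner_component q.
pose cr := corner_component r.
have nA3 := tens_nondegenerate nA nAA.
have nA3' := tens_nondegenerate nAA nA.
have lm X := (@memb_hom K X).1.
have lcD p q := (component_Delta_hom p q).1.
have uD : restr (corner_tens (corner_tens cp cq) cr) (hom_tens Delta (@memb K A) u) =
    hom_tens (@component_Delta p q) (@memb K _) t.
  rewrite tE; apply: restr_hom_tens => // z; first by rewrite component_DeltaE.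
  exact: restr_memb.
have vD : restr (corner_tens cp (corner_tens cq cr)) (hom_tens (@memb K A) Delta v) =
    hom_tens (@memb K _) (@component_Delta q r) s.
  rewrite sE; apply: restr_hom_tens => // z; last by rewrite component_DeltaE.
  exact: restr_memb.
have := congr1 (restr (corner_tens cp (corner_tens cq cr)))
  ((mha_coassoc hA) (cinj a) (cinj x) (cinj c) u v uE vE).
rewrite (restr_hom _ nA3).2 restr_massoc (restr_hom _ nA3').2.
rewrite -[tlift _ u]/(hom_tens Delta (@memb K A) u) uD.
rewrite -[tlift _ v]/(hom_tens (@memb K A) Delta v) vD.
by rewrite !restr_mtens !restr_mone !restr_memb !cK.
Qed.

Lemma component_coalgebra : multiplier_Hopf_coalgebra component_Delta.
Proof.
split.
- exact: nB.
- exact: component_Delta_hom.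
- exact: component_covered.
- exact: component_coassociative.
- exact: component_bijective_coact.
Qed.

(** * The isomorphism onto the direct sum of the components *)

Lemma cproj_fin a : finite_set [set p | cproj p a != 0].
Proof.
have : lspan [set lact (E p) a | p in [set: G] & a in [set: A]] a.
  by rewrite lspan_gamma_delta.
apply: (lspan_ind (P := [set a | finite_set [set p | cproj p a != 0]])).
  split=> [|k u v hu hv] /=.
    by apply: (sub_finite_set _ (@finite_set0 _)) => p /=; rewrite (linear0' (@lp p)) eqxx.
  have hU := conj hu hv; rewrite /= -finite_setU in hU.
  apply: (sub_finite_set _ hU) => p /=; rewrite lp => h.
  have [u0|/eqP un] := pselect (cproj p u = 0); last by left.
  by right; rewrite u0 scaler0 add0r in h.
(* A generator [lact (E p) b] can have a nonzero component only at [p]. *)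
move=> _ [p _ [b _ <-]] /=; apply: (sub_finite_set _ (finite_set1 p)) => q /=.
rewrite -cinj_cproj; have [//|ne] := eqVneq q p.
by rewrite cproj_cinj_neq ?eqxx.
Qed.

Definition decompose a : dsum component := DSum (cproj_fin a).

Lemma decompose_hom : alg_hom decompose.
Proof.
split=> [k a b|a b]; apply: dsum_ext => p; first exact: (@lp p).
exact: (corner_proj (corner_component p)).2.
Qed.

Lemma decompose_cinj p (x : component p) : decompose (cinj x) = dinj x.
Proof.
apply: dsum_ext => q; rewrite /decompose /dinj /=.
have [e|ne] := pselect (p = q).
  by case: _ / e; rewrite dinj_funE (cornerK (corner_component p)).
by rewrite dinj_fun_neq // cproj_cinj_neq //; apply/eqP => /esym.
Qed.

Lemma decompose_bij : bijective decompose.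
Proof.
have ld := decompose_hom.1.
rewrite -setTT_bijective; split=> // [a b _ _ e|b _].
  apply/eqP; rewrite -subr_eq0; apply/eqP; apply: cproj_joint_inj => p.
  by rewrite (linearB' _ _ (@lp p)) -[cproj p a]/(decompose a p) e subrr.
have [s _ ->] := dsum_sum b; exists (\sum_(p <- s) cinj (b p)) => //.
by rewrite (linear_sum' _ _ ld); apply: eq_bigr => p _; exact: decompose_cinj.
Qed.

Let ndsum := dsum_nondegenerate nB.

(** By [mext_iso] it suffices to compare the actions on [A ⊗ A]. Blocks separate the elements of the
    tensor square of the direct sum, and in each block both sides act through the compression of
    [Delta a]. *)
Lemma decompose_Delta a : Delta_G component_Delta (decompose a) =
  mext (fun t => memb (tmap decompose decompose t)) (Delta a).
Proof.
have [hd [g dK gK]] := (decompose_hom, decompose_bij).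
have ld := hd.1.
have lg : linear g by move=> k x y; apply: (can_inj dK); rewrite ld !gK.
have ldp p := (dproj_hom component p).1.
have ndd := tens_nondegenerate ndsum ndsum.
have c2 (p q : G) := corner_tens (corner_dsum component p) (corner_dsum component q).
have proj_d p q t : dproj2 p q (tmap decompose decompose t) = cpr (p, q) t.
  move: t; apply: tens_eq_linear => [||u v].
  - exact: linear_comp (dproj2_hom _ _ _ _).1 (tmap_linear ld ld).
  - exact: (tmap_linear (@lp p) (@lp q)).
  by rewrite /dproj2 (tmap_pure ld ld) (tmap_pure (@ldp _) (@ldp _)) /cpr (tmap_pure (@lp _) (@lp _)).
have dproj2_inj s t : (forall p q, dproj2 p q s = dproj2 p q t) ->
    s = t :> tens (dsum component) (dsum component).
  move=> h; apply/eqP; rewrite -subr_eq0; apply/eqP.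
  have dinj0 (b : dsum component) : (forall p, dproj p b = 0) -> b = 0.
    by move=> hb; apply: dsum_ext.
  apply: (tmap_joint_inj ldp dinj0 ldp dinj0) => p q.
  by rewrite -/(dproj2 p q (s - t)) (linearB' _ _ (dproj2_hom _ _ _ _).1) h subrr.
have restr_mfam2 x p q : restr (c2 p q) (mfam2 x) = x p q.
  apply: mult_ext => t.
    by rewrite lact_restr lact_mfam2; exact: dproj2K.
  by rewrite ract_restr ract_mfam2; exact: dproj2K.
apply/esym/mext_iso => //.
- exact: tmap_hom.
- exists (tmap g g).
    apply: (tens_eq_linear (f := fun t => tmap g g (tmap decompose decompose t)) (g := id)) => //.
      exact: linear_comp (tmap_linear lg lg) (tmap_linear ld ld).
    by move=> u v; rewrite !tmap_pure // !dK.
  apply: (tens_eq_linear (f := fun t => tmap decompose decompose (tmap g g t)) (g := id)) => //.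
    exact: linear_comp (tmap_linear ld ld) (tmap_linear lg lg).
  by move=> u v; rewrite !tmap_pure // !gK.
- move=> t; apply: dproj2_inj => p q.
  rewrite -[RHS](lact_restr_proj (c2 p q) ndd) restr_mfam2 -/(dproj2 p q _) !proj_d.
  by rewrite component_DeltaE (lact_restr_proj (corner2 p q) nAA).
- move=> t; apply: dproj2_inj => p q.
  rewrite -[RHS](ract_restr_proj (c2 p q) ndd) restr_mfam2 -/(dproj2 p q _) !proj_d.
  by rewrite component_DeltaE (ract_restr_proj (corner2 p q) nAA).
Qed.

(** By [gamma_delta], the multiplier [gamma f] acts on the component at [p] as the scalar [f p];
    [mext_iso] then identifies its image. *)
Lemma decompose_gamma f :
  mext (fun a => memb (decompose a)) (gamma f) = gamma_G component f.
Proof.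
have e a p : cproj p (lact (gamma f) a) = (f p : K) *: cproj p a.
  apply: val_inj => /=.
  by rewrite -lact_mmul -central gamma_delta.
apply: mext_iso => //; try exact: decompose_hom; try exact: decompose_bij.
  by move=> a; apply: dsum_ext => p; exact: e.
by move=> a; apply: dsum_ext => p; rewrite -lact_ract_gamma; exact: e.
Qed.

End Grading.

Theorem proposition4p2 (R : realType) (G : groupType)
    (A : nualgType R[i]) (Delta : A -> mult (tens A A))
    (gamma : fun_alg (K := R[i]) G -> mult A)
    (hA : multiplier_Hopf_algebra Delta)
    (hgamma : alg_hom gamma)
    (ndgamma : nondegenerate_hom gamma)
    (central : forall (f : fun_alg (K := R[i]) G) (x : mult A),
       gamma f ** x = x ** gamma f)
    (compat : forall f : fun_alg (K := R[i]) G,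
       mext Delta (gamma f) = mext (hom_tens gamma gamma) (Delta_circ f)) :
  exists (B : G -> nualgType R[i])
         (D : forall p q : G, B (p * q)%g -> mult (tens (B p) (B q))),
    multiplier_Hopf_coalgebra D /\
    exists phi : A -> dsum B,
      [/\ alg_hom phi, bijective phi,
          forall a : A,
            Delta_G D (phi a) = mext (fun t => memb (tmap phi phi t)) (Delta a)
        & forall f : fun_alg (K := R[i]) G,
            mext (fun a => memb (phi a)) (gamma f) = gamma_G B f].
Proof.
exists (component gamma), (component_Delta hA hgamma central); split.
  exact: component_coalgebra.
exists (decompose hA hgamma ndgamma central); split.
- exact: decompose_hom.
- exact: decompose_bij.
- exact: decompose_Delta.
- exact: decompose_gamma.
Qed.
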